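(* Let $M$ be a complete open Riemannian $n$-manifold and $p\in M$ any fixed point. Then there exists a locally Lipschitz function $G(t)$ on $[0,\infty)$ such that the radial curvature of $M$ at $p$ is bounded from below by that of the non-compact model surface of revolution with radial curvature function $G(t)$.
   Context: ''Open'' means non-compact (connected, without boundary). For a locally Lipschitz function $G$ on $[0,\infty)$, the non-compact model surface of revolution with radial curvature function $G$ is the surface with base point $\tilde p$ and metric $dt^2+f(t)^2d\theta^2$, $(t,\theta)\in(0,\infty)\times\mathbb{S}^1_{\tilde p}$, in polar coordinates around $\tilde p$ ($\mathbb{S}^1_{\tilde p}$ the unit circle), where $f$ is the solution of $f''(t)+G(t)f(t)=0$, $f(0)=0$, $f'(0)=1$, with $f>0$ on $(0,\infty)$. Since $G$ is only locally Lipschitz, this metric need not be smooth. The radial curvature of $M$ at $p$ is bounded from below by that of this model if, along every unit speed minimal geodesic $\gamma:[0,a)\to M$ with $\gamma(0)=p$, the sectional curvature satisfies $K_M(\sigma_t)\ge G(t)$ for all $t\in[0,a)$ and all $2$-dimensional linear subspaces $\sigma_t\subset T_{\gamma(t)}M$ containing $\gamma'(t)$. *)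

(* Defs.v *)
From HB Require Import structures.
From mathcomp Require Import all_boot all_order all_algebra.
From mathcomp Require Import all_classical all_reals all_analysis.

Set Implicit Arguments.
Unset Strict Implicit.
Unset Printing Implicit Defensive.

Import Order.TTheory GRing.Theory Num.Theory.
Import numFieldNormedType.Exports.

Local Open Scope ring_scope.
Local Open Scope classical_set_scope.

Section Smoothness.
Context {R : realType} {n : nat}.
Implicit Types (U : set 'rV[R]_n) (f : 'rV[R]_n -> R).

Definition partial (a : 'I_n) f (x : 'rV[R]_n) : R := 'D_(delta_mx 0 a) f x.

(* Meant for open U. *)
Fixpoint Ck (k : nat) U f : Prop :=
  {in U, continuous f} /\
  if k is k'.+1 then
    forall a, (forall x, U x -> derivable f x (delta_mx 0 a)) /\
              Ck k' U (partial a f)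
  else True.

Definition smooth_on U f : Prop := forall k, Ck k U f.

Definition smooth_map_on m U (F : 'rV[R]_n -> 'rV[R]_m) : Prop :=
  forall j, smooth_on U (fun x => F x 0 j).

End Smoothness.

(* A connected Riemannian manifold of dimension n without boundary, given by a
   smooth atlas and the Gram matrices of the metric in its charts.
   - [chart i] is a chart with domain [chart_dom i] and inverse
     [chart_inv i]; both are total functions, used only on the domain and on
     its image.
   - [chart_at x] is a chart around x; the tangent space at x is identified
     with 'rV[R]_n through it.
   - Tangent vectors are row vectors, so a change of charts with Jacobian
     matrix J sends v to v *m J, whence the form of [gram_transition]. *)
Record riemannianManifold (R : realType) (n : nat) := RiemannianManifold {
  carrier :> topologicalType;
  carrier_hausdorff : hausdorff_space carrier;
  carrier_second_countable : @second_countable carrier;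
  carrier_connected : connected [set: carrier];

  chart_index : Type;
  chart_dom : chart_index -> set carrier;
  chart : chart_index -> carrier -> 'rV[R]_n;
  chart_inv : chart_index -> 'rV[R]_n -> carrier;
  chart_at : carrier -> chart_index;
  chart_at_dom : forall x, chart_dom (chart_at x) x;
  chart_dom_open : forall i, open (chart_dom i);
  chart_cod_open : forall i, open (chart i @` chart_dom i);
  chartK : forall i x, chart_dom i x -> chart_inv i (chart i x) = x;
  chart_continuous : forall i, {in chart_dom i, continuous (chart i)};
  chart_inv_continuous :
    forall i, {in chart i @` chart_dom i, continuous (chart_inv i)};
  transition_smooth : forall i j,
    smooth_map_on (chart i @` (chart_dom i `&` chart_dom j))
                  (chart j \o chart_inv i);

  gram : chart_index -> 'rV[R]_n -> 'M[R]_n;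
  gram_smooth : forall i a b,
    smooth_on (chart i @` chart_dom i) (fun x => gram i x a b);
  gram_sym : forall i x, (chart i @` chart_dom i) x -> (gram i x)^T = gram i x;
  gram_pos : forall i x, (chart i @` chart_dom i) x ->
    forall v : 'rV[R]_n, v != 0 -> 0 < (v *m gram i x *m v^T) 0 0;
  gram_transition : forall i j x, chart_dom i x -> chart_dom j x ->
    let J := 'J (chart j \o chart_inv i) (chart i x) in
    gram i (chart i x) = J *m gram j (chart j x) *m J^T
}.

Section LocalCurvature.
Context {R : realType} {n : nat}.
Variable g : 'rV[R]_n -> 'M[R]_n.

(* [christoffel c a b x] is Gamma^c_(ab) at x. *)
Definition christoffel (c a b : 'I_n) (x : 'rV[R]_n) : R :=
  2^-1 * \sum_d invmx (g x) c d *
    (partial a (fun y => g y b d) x + partial b (fun y => g y a d) x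
     - partial d (fun y => g y a b) x).

(* The d-th component of R(e_a, e_b) e_c, with
   R(X, Y) Z = nabla_X nabla_Y Z - nabla_Y nabla_X Z - nabla_[X, Y] Z. *)
Definition riemann (a b c d : 'I_n) (x : 'rV[R]_n) : R :=
  partial a (christoffel d b c) x - partial b (christoffel d a c) x
  + \sum_e (christoffel e b c x * christoffel d a e x
            - christoffel e a c x * christoffel d b e x).

End LocalCurvature.

Section RiemannianGeometry.
Context {R : realType} {n : nat} {M : riemannianManifold R n}.
Implicit Types (x y z p : M) (u v w : 'rV[R]_n) (c : R -> M).

(* Tangent vectors at x are given by coordinates in the chart [chart_at x]. *)
Definition metric x u v : R :=
  (u *m gram (chart_at x) (chart (chart_at x) x) *m v^T) 0 0.

Definition curvature x u v w : 'rV[R]_n :=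
  \row_d \sum_a \sum_b \sum_c
    u 0 a * v 0 b * w 0 c *
    riemann (gram (chart_at x)) a b c d (chart (chart_at x) x).

(* The plane is the row space of [sigma], whose rows form a basis of it when
   [row_free sigma]. *)
Definition sectional_curvature x (sigma : 'M[R]_(2, n)) : R :=
  let u := row 0 sigma in
  let v := row 1 sigma in
  metric x (curvature x u v v) u /
  (metric x u u * metric x v v - metric x u v ^+ 2).

(* Only the values near t matter: a curve that is smooth on an interval up to
   an endpoint is regarded as extended smoothly past it. *)
Definition smooth_curve_at c (t : R) : Prop :=
  exists i, \forall s \near t, chart_dom i (c s) /\
    forall k, derivable (derive1n k (chart i \o c)) s 1.

Definition velocity c (t : R) : 'rV[R]_n :=
  derive1 (chart (chart_at (c t)) \o c) t.

Definition speed c (t : R) : R :=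
  Num.sqrt (metric (c t) (velocity c t) (velocity c t)).

Definition curve_length c (a b : R) : R :=
  \int[lebesgue_measure]_(t in `[a, b]) speed c t.

(* [joined x y l]: some piecewise smooth curve from x to y, given as the list
   of its smooth pieces, has length l. *)
Inductive joined : M -> M -> R -> Prop :=
| joined_refl x : joined x x 0
| joined_step c (a b : R) z l :
    a <= b -> (forall t, t \in `[a, b] -> smooth_curve_at c t) ->
    joined (c b) z l -> joined (c a) z (curve_length c a b + l).

Definition riemannian_dist x y : R := inf [set l | joined x y l].

Definition geodesic_at c (t : R) : Prop :=
  let i := chart_at (c t) in
  let xi := chart i \o c in
  smooth_curve_at c t /\
  forall k, derive1n 2 xi t 0 k +
    \sum_a \sum_b christoffel (gram i) k a b (xi t)
                  * derive1 xi t 0 a * derive1 xi t 0 b = 0.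

(* A unit speed minimal geodesic [0, a) -> M; a may be +oo. *)
Definition unit_minimal_geodesic c (a : \bar R) : Prop :=
  (forall t : R, 0 <= t -> (t%:E < a)%E -> geodesic_at c t /\ speed c t = 1) /\
  (forall s t : R, 0 <= s -> s <= t -> (t%:E < a)%E ->
     curve_length c s t = riemannian_dist (c s) (c t)).

End RiemannianGeometry.

Definition complete_manifold (R : realType) (n : nat)
    (M : riemannianManifold R n) : Prop :=
  forall u : nat -> M,
    (forall e : R, 0 < e -> exists N, forall k l, (N <= k)%N -> (N <= l)%N ->
       riemannian_dist (u k) (u l) < e) ->
    exists x : M, riemannian_dist (u k) x @[k --> \oo] --> (0 : R).

(* Connectedness and the absence of boundary are built into
   [riemannianManifold]. *)
Definition open_manifold (R : realType) (n : nat)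
    (M : riemannianManifold R n) : Prop := ~ compact [set: M].

(* The non-compact model surface of revolution with radial curvature function
   G: [polar_metric t theta] is the Gram matrix of dt^2 + f(t)^2 dtheta^2 at
   the point with polar coordinates t > 0 and theta (an angle mod 2 pi, on
   which nothing depends) around the base point, and [warping] is f.
   Derivatives at 0 are two-sided: a solution on [0, oo) extends past 0. *)
Record modelSurface (R : realType) (G : R -> R) := ModelSurface {
  warping : R -> R;
  warping_derivable : forall t, 0 <= t ->
    derivable warping t 1 /\ derivable (derive1 warping) t 1;
  warping_ode : forall t, 0 <= t -> derive1n 2 warping t + G t * warping t = 0;
  warping0 : warping 0 = 0;
  dwarping0 : derive1 warping 0 = 1;
  warping_gt0 : forall t, 0 < t -> 0 < warping t;
  polar_metric : R -> R -> 'M[R]_2;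
  polar_metricE : forall t theta, 0 < t ->
    polar_metric t theta =
      \matrix_(i, j) (if i != j then 0
                      else if i == 0 then 1 else warping t ^+ 2)
}.

Definition model_radial_curvature (R : realType) (G : R -> R)
    (S : modelSurface G) : R -> R := G.

Definition radial_curvature_bounded_below (R : realType) (n : nat)
    (M : riemannianManifold R n) (p : M) (G : R -> R) (S : modelSurface G) :
    Prop :=
  forall (c : R -> M) (a : \bar R),
    unit_minimal_geodesic c a -> c 0 = p ->
    forall t : R, 0 <= t -> (t%:E < a)%E ->
    forall sigma : 'M[R]_(2, n), row_free sigma ->
      (velocity c t <= sigma)%MS ->
      model_radial_curvature S t <= sectional_curvature (c t) sigma.

(* Main.v *)
(** The sectional curvature near a point is bounded below in a fixed chart by
compactness; since the curvature is a tensor and skew with respect to the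
metric, this bound does not depend on the charts [chart_at y] in which the
curvatures at the points y nearby are computed.  As in the Hopf-Rinow theorem,
completeness makes the set of points reached from p by unit speed minimal
geodesics within time r relatively compact, so the curvature is at least some
- a_k at all points reached within time k + 1.  It remains to produce a model
with G t <= - a_k for t >= k.  With f t = t exp (h t - h 0) and h' t = t m t one has
f'' / f = 3 m + t m' + t^2 m^2, so it suffices to take for m a locally finite
sum of truncated cubes a_k max(0, t - k + 1)^3. *)

From HB Require Import structures.
Require Import Defs.
From mathcomp Require Import all_boot all_order all_algebra.
From mathcomp Require Import all_classical all_reals all_analysis.
From mathcomp Require Import ring lra.
Import Order.TTheory GRing.Theory Num.Theory.
Import numFieldNormedType.Exports.
Local Open Scope ring_scope.
Local Open Scope classical_set_scope.

Set Implicit Arguments.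
Unset Strict Implicit.
Unset Printing Implicit Defensive.

(** * Functions of class C^k *)

(** No geodesic is ever constructed and no exponential map appears: only points already lying on
    minimal geodesics from [p] are controlled. Lengths of paths ([joined]) take the place of a
    metric space structure. Two facts link them to the topology: nearby points are joined by short
    paths, and around each point there is a function, positive only inside a compact set, whose
    variation along a path is at most the length of the path. The second keeps short paths from
    escaping. [chart_at] is an arbitrary choice, so curvatures and speeds depend on the point in no
    controlled way until they are shown to be the same in all charts; the calculus of the first half
    serves this purpose. For the model no differential equation is solved: f is chosen first and G
    is read off as - f'' / f. With f = t exp (h - h 0) this quotient contains 2 h' / t, and the
    factor t in h' = t m removes the pole at 0. *)

Section Calculus.
Context {R : realType}.

Lemma is_derive_line (V W : normedModType R) (f : V -> W) (y v : V) (s : R) :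
  derivable f (y + s *: v) v ->
  is_derive s 1 (fun r : R => f (y + r *: v)) ('D_v f (y + s *: v)).
Proof.
move=> df.
have E : (fun h : R => h^-1 *: (((fun r : R => f (y + r *: v)) \o shift s) (h *: 1)
            - f (y + s *: v))) =
         (fun h : R => h^-1 *: ((f \o shift (y + s *: v)) (h *: v) - f (y + s *: v))).
  apply/funext => h /=; rewrite [h *: 1]mulr1 scalerDl.
  by rewrite addrCA.
by split; [rewrite /derivable E|rewrite /derive E].
Qed.

Lemma MVT_line (V : normedModType R) (f : V -> R) (y v : V) (c : R) :
  (forall s : R, `|s| <= `|c| -> derivable f (y + s *: v) v) ->
  exists2 s : R, `|s| <= `|c| & f (y + c *: v) - f y = c * 'D_v f (y + s *: v).
Proof.
move=> df; pose g r := f (y + r *: v).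
have dg (s : R) : `|s| <= `|c| -> is_derive s 1 g ('D_v f (y + s *: v)).
  by move=> sc; apply: is_derive_line; exact: df.
have g0 : g 0 = f y by rewrite /g scale0r addr0.
have cg a b : (forall x, x \in `[a, b]%R -> `|x| <= `|c|) ->
    {within `[a, b], continuous g}.
  move=> abc; apply: derivable_within_continuous => x xab; by have [] := dg _ (abc _ xab).
have [c0|c0] := leP 0 c.
  have H x : x \in `[0, c]%R -> `|x| <= `|c|.
    by rewrite in_itv/= => /andP[x0 xc]; rewrite !ger0_norm.
  have [s sc E] := MVT_segment c0 (fun x xc => dg x (H x (subset_itv_oo_cc xc))) (cg _ _ H).
  by exists s; [exact: H|rewrite -g0 -/(g c) E subr0 mulrC].
have H x : x \in `[c, 0]%R -> `|x| <= `|c|.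
  by rewrite in_itv/= => /andP[x0 xc]; rewrite !ler0_norm ?lerN2 // ltW.
have [s sc E] := MVT_segment (ltW c0) (fun x xc => dg x (H x (subset_itv_oo_cc xc))) (cg _ _ H).
exists s; first exact: H.
by rewrite -g0 -/(g c) -opprB E sub0r mulrN opprK mulrC.
Qed.

Lemma cvg_sum (I T : Type) (r : seq I) (P : pred I) (F : set_system T)
    (f : I -> T -> R) (l : I -> R) : Filter F ->
  (forall i, P i -> f i x @[x --> F] --> l i) ->
  \sum_(i <- r | P i) f i x @[x --> F] --> \sum_(i <- r | P i) l i.
Proof.
move=> FF H; elim: r => [|i r IH].
  under eq_fun do rewrite big_nil; rewrite big_nil; exact: cvg_cst.
under eq_fun do rewrite big_cons; rewrite big_cons.
by case: ifP => // Pi; apply: cvgD => //; exact: H.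
Qed.

Lemma norm_delta_mx n (a : 'I_n) : `|delta_mx 0 a : 'rV[R]_n| <= 1.
Proof.
rewrite [leLHS]/Num.Def.normr/= mx_normrE; apply: bigmax_le => // -[i j] _.
by rewrite !mxE /=; case: (_ && _); rewrite ?normr1 ?normr0.
Qed.

Lemma norm_coord_le n (h : 'rV[R]_n) (a : 'I_n) : `|h 0 a| <= `|h|.
Proof.
rewrite [leRHS]/Num.Def.normr/= mx_normrE.
exact: (le_bigmax _ (fun i : 'I_1 * 'I_n => `|h i.1 i.2|) (0, a)).
Qed.

Lemma norm_row_le n (h : 'rV[R]_n) e :
  0 <= e -> (forall a, `|h 0 a| <= e) -> `|h| <= e.
Proof.
move=> e0 H; rewrite [leLHS]/Num.Def.normr/= mx_normrE.
by apply: bigmax_le => // -[i j] _ /=; rewrite ord1.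
Qed.

Lemma differentiable_littleo (V W : normedModType R) (f : V -> W)
    (L : {linear V -> W}) (x : V) : continuous L ->
  (forall e : R, 0 < e ->
     \forall h \near 0, `|f (h + x) - (f x + L h)| <= e * `|h|) ->
  differentiable f x.
Proof.
move=> cL H; apply/diff_locallyP.
have E : f \o shift x = cst (f x) + L +o_ 0 id.
  by apply/eqaddoP => e /H; apply: filterS => h.
have dE := diff_unique cL E.
by split; rewrite dE.
Qed.

Lemma differentiable_partial n (f : 'rV[R]_n -> R) (x : 'rV[R]_n) :
  (\forall y \near x, forall a, derivable f y (delta_mx 0 a)) ->
  (forall a, {for x, continuous (partial a f)}) ->
  differentiable f x.
Proof.
move=> df cf.
pose L (h : 'rV[R]_n) := \sum_a h 0 a * partial a f x.
have L_lin : linear (L : _ -> R^o).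
  move=> c u v; rewrite /L scaler_sumr -big_split /=; apply: eq_bigr => a _.
  by rewrite !mxE mulrDl scalerAl.
pose LL : {linear 'rV[R]_n -> R^o} := HB.pack L (GRing.isLinear.Build _ _ _ _ _ L_lin).
have L_cont : continuous LL.
  move=> h; rewrite /LL /= /L; apply: (@cvg_sum _ _ _ _ (nbhs h)) => a _.
  by apply: cvgMr_tmp; exact: coord_continuous.
apply: (@differentiable_littleo _ _ _ LL) => // _/posnumP[e].
  (* The increment splits into [n] coordinate steps, each with error at most [e'] times the norm of
     [h]; dividing by [n + 1] also covers [n = 0]. *)
  pose e' := e%:num / n.+1%:R.
  have e'0 : 0 < e' by rewrite divr_gt0.
  have near1 : \forall y \near x, forall a,
      derivable f y (delta_mx 0 a) /\ `|partial a f x - partial a f y| <= e'.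
    have H : \forall y \near x, forall a : 'I_n, `|partial a f x - partial a f y| <= e'.
      by apply: (@filter_forall _ _ (fun a y => `|partial a f x - partial a f y| <= e') (nbhs x)) => a; have /cvgrPdist_le := cf a; apply.
    by apply: filterS2 df H => y d H a.
  have /nbhs_ballP[d /= d0 near2] := near1.
  have {}near2 (h : 'rV[R]_n) : `|h| < d -> forall a,
      derivable f (x + h) (delta_mx 0 a) /\ `|partial a f x - partial a f (x + h)| <= e'.
    by move=> hd; apply: near2; rewrite -ball_normE /= opprD addrA subrr sub0r normrN.
  apply/nbhs_ballP; exists d => //= h.
  rewrite -ball_normE /= sub0r normrN => hd.
  (* [T k] keeps the first [k] coordinates of [h]: the way from [x] to [x + h] changes one
     coordinate at a time, and the mean value theorem applies to each step. *)
  pose T k := \row_(j < n) (if (j < k)%N then h 0 j else 0) : 'rV[R]_n.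
  have Tn : T n = h by apply/rowP => j; rewrite mxE ltn_ord.
  have T0 : T 0%N = 0 by apply/rowP => j; rewrite !mxE.
  have -> : f (h + x) - (f x + L h) =
      \sum_(k < n) (f (x + T k.+1) - f (x + T k) - h 0 k * partial k f x).
    rewrite sumrB -/(L h) opprD addrA; congr (_ - _).
    rewrite -(big_mkord xpredT (fun k => f (x + T k.+1) - f (x + T k))).
    by rewrite telescope_sumr // Tn T0 addr0 [h + x]addrC.
  apply: le_trans (ler_norm_sum _ _ _) _.
  apply: (@le_trans _ _ (\sum_(k < n) e' * `|h|)).
    apply: ler_sum => k _.
    have TS : T k.+1 = T k + h 0 k *: delta_mx 0 k.
      apply/rowP => j; rewrite !mxE ltnS leq_eqVlt /= -(inj_eq val_inj).
      have [/val_inj -> /=|] := eqVneq (j : nat) k; last by rewrite /= mulr0 addr0.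
      by rewrite ltnn mulr1 add0r.
    have small s : `|s| <= `|h 0 k| -> `|T k + s *: delta_mx 0 k| < d.
      move=> sh; apply: le_lt_trans hd; apply: norm_row_le => // j.
      rewrite !mxE /= -(inj_eq val_inj).
      have [/val_inj -> /=|] := eqVneq (j : nat) k.
        by rewrite ltnn mulr1 add0r (le_trans sh) // norm_coord_le.
      rewrite /= mulr0 addr0; case: (j < k)%N; by rewrite ?normr0 ?norm_coord_le.
    have [|s sh E] := @MVT_line _ f (x + T k) (delta_mx 0 k) (h 0 k).
      by move=> s /small sd; rewrite -addrA; exact: (near2 _ sd k).1.
    rewrite TS addrA E -mulrBr normrM mulrC; apply: ler_pM => //; last exact: norm_coord_le.
    by rewrite distrC -addrA; exact: (near2 _ (small _ sh) k).2.
  rewrite sumr_const card_ord -mulr_natr /e' /= mulrAC.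
  rewrite ler_wpM2r // -mulrA ler_piMr // ler_pdivrMl // mulr1 ler_nat //.
Qed.

Lemma distr_halves (a b c d e : R) : c = d ->
  `|a - c| <= e / 2 -> `|b - d| <= e / 2 -> `|a - b| <= e.
Proof.
move=> -> ad bd; rewrite -(subrKA d) [e]splitr.
by apply: le_trans (ler_normD _ _) _; rewrite lerD// distrC.
Qed.

(** * Closure properties of C^k and Schwarz's theorem *)

Section CkTheory.
Context {n : nat} (U : set 'rV[R]_n) (oU : open U).
Implicit Types (f g : 'rV[R]_n -> R) (x : 'rV[R]_n).

Lemma near_in x : U x -> \forall y \near x, U y.
Proof. by move=> Ux; apply: open_nbhs_nbhs. Qed.

Lemma Ck_continuous k f x : Ck k U f -> U x -> {for x, continuous f}.
Proof. by case: k => [|k] [cf _] Ux; apply: cf; rewrite inE. Qed.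

Lemma Ck_partial k f a : Ck k.+1 U f -> Ck k U (partial a f).
Proof. by move=> [_ /(_ a) []]. Qed.

Lemma Ck_derivable k f a x : Ck k.+1 U f -> U x -> derivable f x (delta_mx 0 a).
Proof. by move=> [_ /(_ a) [df _]]; exact: df. Qed.

Lemma CkS k f : Ck k.+1 U f -> Ck k U f.
Proof.
elim: k f => [|k IH] f [cf df]; split=> // a.
by have [dfa /IH] := df a.
Qed.

Lemma near_eq_in f g x : {in U, f =1 g} -> U x -> \forall y \near x, f y = g y.
Proof. by move=> fg /near_in; apply: filterS => y Uy; apply: fg; rewrite inE. Qed.

Lemma Ck_congr k f g : {in U, f =1 g} -> Ck k U f -> Ck k U g.
Proof.
elim: k f g => [|k IH] f g fg [cf df].
  split=> // x; rewrite inE => Ux; rewrite /continuous_at -fg ?inE//.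
  apply: cvg_trans (cf x _); last by rewrite inE.
  exact: near_eq_cvg (near_eq_in fg Ux).
split=> [x|a].
  rewrite inE => Ux; rewrite /continuous_at -fg ?inE//.
  apply: cvg_trans (cf x _); last by rewrite inE.
  exact: near_eq_cvg (near_eq_in fg Ux).
have [dfa Cfa] := df a; split=> [x Ux|].
  by apply: near_eq_derivable (dfa _ Ux); exact: near_eq_in Ux.
apply: IH Cfa => x; rewrite inE => Ux; apply: near_eq_derive.
exact: near_eq_in Ux.
Qed.

Lemma CkI k f : {in U, continuous f} ->
  (forall a x, U x -> derivable f x (delta_mx 0 a)) ->
  (forall a, exists2 df, {in U, partial a f =1 df} & Ck k U df) -> Ck k.+1 U f.
Proof.
move=> cf df H; split=> // a; split; first exact: df.
have [g fg Cg] := H a; apply: Ck_congr Cg => x xU; exact/esym/fg.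
Qed.

Lemma Ck_cst k (c : R) : Ck k U (cst c).
Proof.
elim: k c => [|k IH] c; first by split=> // x _; exact: cst_continuous.
apply: CkI => [x _|a x _|a]; [exact: cst_continuous|exact: derivable_cst|].
by exists (cst 0) => // x _; exact: derive_cst.
Qed.

Lemma CkD k f g : Ck k U f -> Ck k U g -> Ck k U (fun x => f x + g x).
Proof.
elim: k f g => [|k IH] f g Cf Cg.
  by split=> // x; rewrite inE => Ux; apply: continuousD;
    [exact: Ck_continuous Cf Ux|exact: Ck_continuous Cg Ux].
apply: CkI => [x|a x Ux|a].
- by rewrite inE => Ux; apply: continuousD;
    [exact: Ck_continuous Cf Ux|exact: Ck_continuous Cg Ux].
- by apply: derivableD; [exact: Ck_derivable Cf Ux|exact: Ck_derivable Cg Ux].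
- exists (fun x => partial a f x + partial a g x) => [x|].
    rewrite inE => Ux.
    by rewrite /partial deriveD //; [exact: Ck_derivable Cf Ux|exact: Ck_derivable Cg Ux].
  by apply: IH; exact: Ck_partial.
Qed.

Lemma CkM k f g : Ck k U f -> Ck k U g -> Ck k U (fun x => f x * g x).
Proof.
elim: k f g => [|k IH] f g Cf Cg.
  by split=> // x; rewrite inE => Ux; apply: continuousM;
    [exact: Ck_continuous Cf Ux|exact: Ck_continuous Cg Ux].
apply: CkI => [x|a x Ux|a].
- by rewrite inE => Ux; apply: continuousM;
    [exact: Ck_continuous Cf Ux|exact: Ck_continuous Cg Ux].
- by apply: derivableM; [exact: Ck_derivable Cf Ux|exact: Ck_derivable Cg Ux].
- exists (fun x => f x * partial a g x + g x * partial a f x) => [x|].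
    rewrite inE => Ux.
    by rewrite /partial deriveM //; [exact: Ck_derivable Cf Ux|exact: Ck_derivable Cg Ux].
  by apply: CkD; apply: IH; do ?[exact: CkS|exact: Ck_partial].
Qed.

Lemma CkN k f : Ck k U f -> Ck k U (fun x => - f x).
Proof.
by move=> Cf; apply: Ck_congr (CkM (Ck_cst k (-1)) Cf) => x _; rewrite mulN1r.
Qed.

Lemma CkB k f g : Ck k U f -> Ck k U g -> Ck k U (fun x => f x - g x).
Proof. by move=> Cf Cg; apply: CkD => //; exact: CkN. Qed.

Lemma Ck_sum k (I : Type) (r : seq I) (P : pred I) (F : I -> 'rV[R]_n -> R) :
  (forall i, P i -> Ck k U (F i)) -> Ck k U (fun x => \sum_(i <- r | P i) F i x).
Proof.
move=> H; elim: r => [|i r IH].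
  by apply: Ck_congr (Ck_cst k 0) => x _; rewrite big_nil.
have [Pi|nPi] := boolP (P i).
  by apply: Ck_congr (CkD (H i Pi) IH) => x _; rewrite big_cons Pi.
by apply: Ck_congr IH => x _; rewrite big_cons (negbTE nPi).
Qed.

Lemma Ck_prod k (I : Type) (r : seq I) (P : pred I) (F : I -> 'rV[R]_n -> R) :
  (forall i, P i -> Ck k U (F i)) -> Ck k U (fun x => \prod_(i <- r | P i) F i x).
Proof.
move=> H; elim: r => [|i r IH].
  by apply: Ck_congr (Ck_cst k 1) => x _; rewrite big_nil.
have [Pi|nPi] := boolP (P i).
  by apply: Ck_congr (CkM (H i Pi) IH) => x _; rewrite big_cons Pi.
by apply: Ck_congr IH => x _; rewrite big_cons (negbTE nPi).
Qed.

Lemma CkV k f : (forall x, U x -> f x != 0) -> Ck k U f -> Ck k U (fun x => (f x)^-1).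
Proof.
move=> f0; have cV x : {for x, continuous f} -> U x -> {for x, continuous (fun x => (f x)^-1)}.
  by move=> cf Ux; apply: continuousV => //; exact: f0.
elim: k => [|k IH] Cf.
  by split=> // x; rewrite inE => Ux; apply: cV => //; exact: Ck_continuous Cf Ux.
apply: CkI => [x|a x Ux|a].
- by rewrite inE => Ux; apply: cV => //; exact: Ck_continuous Cf Ux.
- by apply: derivableV; [exact: f0|exact: Ck_derivable Cf Ux].
- exists (fun x => - ((f x)^-1 * (f x)^-1 * partial a f x)) => [x|].
    rewrite inE => Ux; rewrite /partial deriveV ?f0 //; last exact: Ck_derivable Cf Ux.
    by rewrite -exprVn expr2 scaleNr.
  have CV := IH (CkS Cf).
  by apply: CkN; apply: CkM; [exact: CkM|exact: Ck_partial].
Qed.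

Lemma Ck_differentiable k f x : Ck k.+1 U f -> U x -> differentiable f x.
Proof.
move=> Cf Ux; apply: differentiable_partial.
  by apply: filterS (near_in Ux) => y Uy a; exact: Ck_derivable Cf Uy.
by move=> a; apply: Ck_continuous (Ck_partial a Cf) Ux.
Qed.

Lemma Ck_deriveE k f x v : Ck k.+1 U f -> U x ->
  'D_v f x = \sum_a v 0 a * partial a f x.
Proof.
move=> Cf Ux; have df := Ck_differentiable Cf Ux.
rewrite deriveE // [in LHS](row_sum_delta v) linear_sum; apply: eq_bigr => a _.
by rewrite linearZ /= -deriveE.
Qed.

Lemma Ck_derive k f v : Ck k.+1 U f -> Ck k U ('D_v f).
Proof.
move=> Cf; apply: (@Ck_congr _ (fun x => \sum_a v 0 a * partial a f x)).
  by move=> x; rewrite inE => Ux; rewrite (Ck_deriveE _ Cf Ux).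
apply: Ck_sum => a _; apply: CkM; [exact: Ck_cst|exact: Ck_partial].
Qed.

(** The second difference of [f] over a square with sides [s] along two coordinate directions is
    symmetric in these directions, and two uses of the mean value theorem turn it into [s ^ 2] times
    a mixed partial at a point near [x]. Continuity of the mixed partials then gives equality at
    [x]. *)
Lemma partialC f a b x : Ck 2 U f -> U x ->
  partial a (partial b f) x = partial b (partial a f) x.
Proof.
move=> Cf Ux.
have /nbhs_ballP[r /= r0 xU] := near_in Ux.
have inU c d (s t s0 t0 : R) : `|s| + `|t| < r -> `|s0| <= `|s| -> `|t0| <= `|t| ->
    U (x + s0 *: delta_mx 0 c + t0 *: delta_mx 0 d).
  move=> st ss tt; apply: xU; rewrite -ball_normE /= opprD addrA opprD addrA subrr sub0r.
  rewrite -opprD normrN (le_lt_trans (ler_normD _ _))// (le_lt_trans _ st)// lerD//.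
    by rewrite normrZ (le_trans _ ss)// ler_piMr// norm_delta_mx.
  by rewrite normrZ (le_trans _ tt)// ler_piMr// norm_delta_mx.
have key c d (s : R) : `|s| + `|s| < r ->
    exists2 y, `|x - y| <= `|s| + `|s| &
      f (x + s *: delta_mx 0 c + s *: delta_mx 0 d) - f (x + s *: delta_mx 0 d)
      - (f (x + s *: delta_mx 0 c) - f x) = s * (s * partial d (partial c f) y).
  move=> sr; pose F y := f (y + s *: delta_mx 0 d) - f y.
  have dF1 (t : R) : `|t| <= `|s| ->
     derivable (fun y => f (y + s *: delta_mx 0 d)) (x + t *: delta_mx 0 c) (delta_mx 0 c)
     /\ 'D_(delta_mx 0 c) (fun y => f (y + s *: delta_mx 0 d)) (x + t *: delta_mx 0 c) =
       partial c f (x + t *: delta_mx 0 c + s *: delta_mx 0 d).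
    move=> ts; have D : derivable f (x + t *: delta_mx 0 c + s *: delta_mx 0 d) (delta_mx 0 c).
      by apply: (Ck_derivable Cf); exact: inU sr _ _.
    have E : (fun h : R => h^-1 *: (((fun y => f (y + s *: delta_mx 0 d)) \o
         shift (x + t *: delta_mx 0 c)) (h *: delta_mx 0 c) -
          f (x + t *: delta_mx 0 c + s *: delta_mx 0 d))) =
         (fun h : R => h^-1 *: ((f \o shift (x + t *: delta_mx 0 c + s *: delta_mx 0 d))
           (h *: delta_mx 0 c) - f (x + t *: delta_mx 0 c + s *: delta_mx 0 d))).
      by apply/funext => h /=; rewrite -!addrA.
    by split; [rewrite /derivable E|rewrite /partial /derive E].
  have dF2 (t : R) : `|t| <= `|s| -> derivable f (x + t *: delta_mx 0 c) (delta_mx 0 c).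
    move=> ts; apply: (Ck_derivable Cf); rewrite -[X in U X]addr0 -(scale0r (delta_mx 0 d)).
    by apply: inU sr _ _; rewrite ?normr0.
  have [|t ts E] := @MVT_line _ F x (delta_mx 0 c) s.
    by move=> t ts; apply: derivableB; [exact: (dF1 _ ts).1|exact: dF2].
  have [|t' ts' E'] := @MVT_line _ (partial c f) (x + t *: delta_mx 0 c) (delta_mx 0 d) s.
    by move=> t' ts'; apply: (Ck_derivable (Ck_partial c Cf)); exact: inU sr _ _.
  exists (x + t *: delta_mx 0 c + t' *: delta_mx 0 d).
    rewrite opprD addrA opprD addrA subrr sub0r -opprD normrN.
    rewrite (le_trans (ler_normD _ _))// lerD// normrZ.
      by rewrite (le_trans _ ts)// ler_piMr// norm_delta_mx.
    by rewrite (le_trans _ ts')// ler_piMr// norm_delta_mx.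
  rewrite [partial d _ _]/(partial _ _ _) -E' -[in RHS]/(partial c f) -/(F _).
  transitivity (F (x + s *: delta_mx 0 c) - F x); first by rewrite /F; ring.
  by rewrite E; congr (_ * _); rewrite deriveB; [rewrite (dF1 _ ts).2|exact: (dF1 _ ts).1|exact: dF2].
apply/eqP; rewrite -subr_eq0 -normr_le0; apply/ler_addgt0Pl => e e0; rewrite addr0.
have c1 := Ck_continuous (Ck_partial a (Ck_partial b Cf)) Ux.
have c2 := Ck_continuous (Ck_partial b (Ck_partial a Cf)) Ux.
have e20 : 0 < e / 2 by rewrite divr_gt0.
move/cvgrPdist_le : c1 => /(_ _ e20) /nbhs_ballP [d1 /= d10 c1].
move/cvgrPdist_le : c2 => /(_ _ e20) /nbhs_ballP [d2 /= d20 c2].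
(* A quarter, so that both displacements together stay below each of the three radii. *)
pose s := (Num.min r (Num.min d1 d2)) / 4.
have m0 : 0 < Num.min r (Num.min d1 d2) by rewrite !lt_min r0 d10 d20.
have s0 : 0 < s by rewrite divr_gt0.
have ss : `|s| + `|s| < Num.min r (Num.min d1 d2).
  by rewrite gtr0_norm // /s; lra.
move: (ss); rewrite !lt_min => /and3P[sr sd1 sd2].
have [y1 y1s E1] := key b a s sr.
have [y2 y2s E2] := key a b s sr.
have E : partial a (partial b f) y1 = partial b (partial a f) y2.
  have sn0 := lt0r_neq0 s0; apply: (mulfI sn0); apply: (mulfI sn0).
  apply: (eq_trans (esym E1)); apply: etrans E2; rewrite (addrAC x).
  have alg (A B C D : R) : A - B - (C - D) = A - C - (B - D) by ring.
  exact: alg.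
have B1 : `|partial a (partial b f) x - partial a (partial b f) y1| <= e / 2.
  by apply: c1; rewrite -ball_normE /=; exact: le_lt_trans y1s sd1.
have B2 : `|partial b (partial a f) x - partial b (partial a f) y2| <= e / 2.
  by apply: c2; rewrite -ball_normE /=; exact: le_lt_trans y2s sd2.
exact: distr_halves E B1 B2.
Qed.

Lemma deriveC f u v x : Ck 2 U f -> U x -> 'D_u ('D_v f) x = 'D_v ('D_u f) x.
Proof.
move=> Cf Ux.
have H w w' : 'D_w ('D_w' f) x = \sum_a \sum_b w 0 a * w' 0 b * partial a (partial b f) x.
  rewrite (Ck_deriveE _ (Ck_derive w' Cf) Ux); apply: eq_bigr => a _.
  rewrite /partial (@near_eq_derive _ _ _ _ (fun y => \sum_b w' 0 b * partial b f y)); last first.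
    by apply: filterS (near_in Ux) => y Uy; rewrite (Ck_deriveE _ Cf Uy).
  have C1 : Ck 1 U (fun y => \sum_b w' 0 b * partial b f y).
    by apply: Ck_sum => b _; apply: CkM; [exact: Ck_cst|exact: Ck_partial].
  have -> : (fun y => \sum_b w' 0 b * partial b f y) = \sum_b (fun y => w' 0 b * partial b f y).
    by apply/funext => y; rewrite fct_sumE.
  have D b : derivable (partial b f) x (delta_mx 0 a) by exact: Ck_derivable (Ck_partial b Cf) Ux.
  rewrite derive_sum; last by move=> b; apply: derivableM => //; exact: derivable_cst.
  rewrite mulr_sumr; apply: eq_bigr => b _.
  by rewrite deriveMl // mulrA.
rewrite !H exchange_big /=; apply: eq_bigr => a _; apply: eq_bigr => b _.
by rewrite [_ * v 0 _]mulrC (partialC _ _ Cf Ux).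
Qed.

End CkTheory.

End Calculus.

(** * Matrix-valued functions *)

Section MatrixDerivative.
Context {R : realType} {V : normedModType R}.

Lemma is_derive_mxP m n (M : V -> 'M[R]_(m, n)) x v (dM : 'M[R]_(m, n)) :
  is_derive x v M dM <->
  forall i j, is_derive x v (fun y => M y i j : R) (dM i j).
Proof.
split=> [[dr <-] i j|H].
  by split; [exact: (derivable_mxP M x v).1|rewrite derive_mx // mxE].
have dr : derivable M x v.
  by apply/derivable_mxP => i j; case: (H i j).
split=> //; rewrite derive_mx //; apply/matrixP => i j; rewrite mxE.
by case: (H i j).
Qed.

Lemma is_derive_sum_fun (I : Type) (r : seq I) (F : I -> V -> R) (dF : I -> R) x v :
  (forall i, is_derive x v (F i) (dF i)) ->
  is_derive x v (fun y => \sum_(i <- r) F i y) (\sum_(i <- r) dF i).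
Proof.
move=> H; elim: r => [|i r IH].
  under eq_fun do rewrite big_nil.
  by rewrite big_nil; exact: is_derive_cst.
under eq_fun do rewrite big_cons.
by rewrite big_cons; exact: is_deriveD.
Qed.

Lemma is_derive_mul (f g : V -> R) (df dg : R) x v :
  is_derive x v f df -> is_derive x v g dg ->
  is_derive x v (fun y => f y * g y) (df * g x + f x * dg).
Proof.
move=> [Hf <-] [Hg <-]; split; first exact: (derivableM Hf Hg).
by rewrite (deriveM Hf Hg) addrC [X in X + _ = _]mulrC.
Qed.

Lemma is_derive_mulmx m n p (A : V -> 'M[R]_(m, n)) (B : V -> 'M[R]_(n, p)) dA dB x v :
  is_derive x v A dA -> is_derive x v B dB ->
  is_derive x v (fun y => A y *m B y) (dA *m B x + A x *m dB).
Proof.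
move=> /is_derive_mxP HA /is_derive_mxP HB; apply/is_derive_mxP => i j.
under eq_fun do rewrite mxE.
rewrite !mxE -big_split /=; apply: is_derive_sum_fun => k.
exact: is_derive_mul.
Qed.

Lemma is_derive_trmx m n (A : V -> 'M[R]_(m, n)) dA x v :
  is_derive x v A dA -> is_derive x v (fun y => (A y)^T) dA^T.
Proof.
move=> /is_derive_mxP HA; apply/is_derive_mxP => i j.
under eq_fun do rewrite mxE.
by rewrite mxE.
Qed.

Lemma differentiable_row n (F : V -> 'rV[R]_n) x :
  (forall j, differentiable (fun y => F y 0 j : R^o) x) -> differentiable F x.
Proof.
move=> H.
have -> : F = \sum_(j < n) (fun y => F y 0 j *: delta_mx 0 j).
  by apply/funext => y; rewrite fct_sumE -row_sum_delta.
by apply: differentiable_sum => j; exact: differentiableZl.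
Qed.

End MatrixDerivative.

Section CkMatrix.
Context {R : realType} {n : nat} (U : set 'rV[R]_n) (oU : open U).

Definition Cmx k p q (F : 'rV[R]_n -> 'M[R]_(p, q)) :=
  forall i j, Ck k U (fun x => F x i j).

Lemma Cmx_is_derive k p q (F : 'rV[R]_n -> 'M[R]_(p, q)) x v :
  Cmx k.+1 F -> U x -> is_derive x v F ('D_v F x).
Proof.
move=> CF Ux; apply/derivableP/derivable_mxP => i j.
exact/diff_derivable/(Ck_differentiable oU (CF i j) Ux).
Qed.

Lemma Cmx_deriveE k p q (F : 'rV[R]_n -> 'M[R]_(p, q)) x v i j :
  Cmx k.+1 F -> U x -> 'D_v F x i j = 'D_v (fun y => F y i j) x.
Proof. by move=> CF Ux; have [dF _] := Cmx_is_derive v CF Ux; rewrite derive_mx // mxE. Qed.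

Lemma Cmx_derive k p q (F : 'rV[R]_n -> 'M[R]_(p, q)) v :
  Cmx k.+1 F -> Cmx k ('D_v F).
Proof.
move=> CF i j; apply: Ck_congr (Ck_derive oU v (CF i j)) => // x.
by rewrite inE => Ux; rewrite (Cmx_deriveE v i j CF Ux).
Qed.

Lemma Cmx_derive2E p q (F : 'rV[R]_n -> 'M[R]_(p, q)) x u v i j :
  Cmx 2 F -> U x -> 'D_u ('D_v F) x i j = 'D_u ('D_v (fun y => F y i j)) x.
Proof.
move=> CF Ux; apply: (eq_trans (Cmx_deriveE _ i j (Cmx_derive v CF) Ux)).
apply: near_eq_derive.
by apply: filterS (near_in oU Ux) => y Uy; rewrite (Cmx_deriveE v i j CF Uy).
Qed.

Lemma Cmx_deriveC p q (F : 'rV[R]_n -> 'M[R]_(p, q)) x u v :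
  Cmx 2 F -> U x -> 'D_u ('D_v F) x = 'D_v ('D_u F) x.
Proof.
move=> CF Ux; apply/matrixP => i j.
apply: (eq_trans (Cmx_derive2E u v i j CF Ux)).
apply: etrans (esym (Cmx_derive2E v u i j CF Ux)).
exact: (deriveC oU u v (CF i j) Ux).
Qed.

Lemma Cmx_differentiable k m (F : 'rV[R]_n -> 'rV[R]_m) x :
  Cmx k.+1 F -> U x -> differentiable F x.
Proof.
by move=> CF Ux; apply: differentiable_row => j; exact: (Ck_differentiable oU (CF 0 j) Ux).
Qed.

Lemma Ck_det k m (A : 'rV[R]_n -> 'M[R]_m) : Cmx k A -> Ck k U (fun x => \det (A x)).
Proof.
move=> CA; apply: Ck_sum => // s _; apply: CkM => //; first exact: Ck_cst.
by apply: Ck_prod => // i _; exact: CA.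
Qed.

(** Cramer's rule: the entries are cofactors divided by the determinant. *)
Lemma Cmx_inv k m (A : 'rV[R]_n -> 'M[R]_m) :
  (forall x, U x -> A x \in unitmx) -> Cmx k A -> Cmx k (fun x => invmx (A x)).
Proof.
move=> uA CA i j.
apply: (@Ck_congr _ _ _ oU _ (fun x => (\det (A x))^-1 * cofactor (A x) j i)).
  by move=> x; rewrite inE => Ux; rewrite /invmx uA // !mxE.
apply: CkM => //.
  apply: CkV => //; last exact: Ck_det.
  by move=> x /uA; rewrite unitmxE unitfE.
rewrite /cofactor; apply: CkM => //; first exact: Ck_cst.
apply: Ck_det => a b; apply: (@Ck_congr _ _ _ oU _ (fun x => A x (lift j a) (lift i b))).
  by move=> x _; rewrite !mxE.
exact: CA.
Qed.

End CkMatrix.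

Lemma Ck_subset (R : realType) n (U V : set 'rV[R]_n) k f : U `<=` V -> Ck k V f -> Ck k U f.
Proof.
move=> UV; elim: k f => [|k IH] f [cf df].
  by split=> // x; rewrite inE => /UV Vx; apply: cf; rewrite inE.
split=> [x|a]; first by rewrite inE => /UV Vx; apply: cf; rewrite inE.
by have [dfa Cfa] := df a; split; [move=> x /UV; exact: dfa|exact: IH].
Qed.

Lemma is_derive_comp_Cmx (R : realType) n m p q (U : set 'rV[R]_n) (V : set 'rV[R]_m)
    (phi : 'rV[R]_n -> 'rV[R]_m) (H : 'rV[R]_m -> 'M[R]_(p, q)) k l x u :
  open U -> open V -> Cmx U k.+1 phi -> Cmx V l.+1 H -> U x -> V (phi x) ->
  is_derive x u (H \o phi) ('D_('D_u phi x) H (phi x)).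
Proof.
move=> oU oV Cphi CH Ux Vx; apply/is_derive_mxP => i j.
have dphi := Cmx_differentiable oU Cphi Ux.
have dH := Ck_differentiable oV (CH i j) Vx.
have dc : differentiable ((fun y => H y i j : R^o) \o phi) x by exact: differentiable_comp.
rewrite (Cmx_deriveE oV _ i j CH Vx).
split; first exact: diff_derivable.
by rewrite (deriveE _ dc) diff_comp // (deriveE _ dphi) deriveE.
Qed.

(** * The Levi-Civita connection of a metric in coordinates *)

Section Bilinear.
Context {R : realType} {n : nat}.
Implicit Types (b : 'I_n -> 'I_n -> 'I_n -> R) (u v w : 'rV[R]_n).

(** Applied to Christoffel symbols this is Gamma(u, v), the covariant derivative of one constant
    field along another; it turns index computations into identities between vectors. *)
Definition bil b u v : 'rV[R]_n := \row_d \sum_i \sum_j u 0 i * v 0 j * b d i j.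

Lemma bilDr b u v v' : bil b u (v + v') = bil b u v + bil b u v'.
Proof.
apply/rowP => d; rewrite !mxE -big_split; apply: eq_bigr => i _ /=.
rewrite -big_split; apply: eq_bigr => j _ /=; rewrite !mxE; ring.
Qed.

Lemma bilZl b c u v : bil b (c *: u) v = c *: bil b u v.
Proof.
apply/rowP => d; rewrite !mxE mulr_sumr; apply: eq_bigr => i _ /=.
rewrite mulr_sumr; apply: eq_bigr => j _ /=; rewrite !mxE; ring.
Qed.

Lemma bilZr b c u v : bil b u (c *: v) = c *: bil b u v.
Proof.
apply/rowP => d; rewrite !mxE mulr_sumr; apply: eq_bigr => i _ /=.
rewrite mulr_sumr; apply: eq_bigr => j _ /=; rewrite !mxE; ring.
Qed.

Lemma bil0l b v : bil b 0 v = 0.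
Proof. by rewrite -[X in bil b X](scale0r v) bilZl scale0r. Qed.

Lemma bil0r b v : bil b v 0 = 0.
Proof. by rewrite -[X in bil b _ X](scale0r v) bilZr scale0r. Qed.

Lemma bilC b u v : (forall d i j, b d i j = b d j i) -> bil b u v = bil b v u.
Proof.
move=> bC; apply/rowP => d; rewrite !mxE exchange_big; apply: eq_bigr => i _ /=.
by apply: eq_bigr => j _; rewrite bC [u 0 j * _]mulrC.
Qed.

Lemma sum3_swap (z w z' : 'rV[R]_n) b :
  \sum_i \sum_j z 0 i * w 0 j * (\sum_a z' 0 a * b a i j) =
  \sum_i \sum_j \sum_k z' 0 i * z 0 j * w 0 k * b i j k.
Proof.
under eq_bigr => i _ do under eq_bigr => j _ do rewrite mulr_sumr.
under eq_bigr => i _ do rewrite exchange_big.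
rewrite exchange_big; apply: eq_bigr => a _; apply: eq_bigr => i _.
by apply: eq_bigr => j _ /=; ring.
Qed.

Lemma sum_bil_bil b (z z' w : 'rV[R]_n) d :
  \sum_i \sum_j z 0 i * bil b z' w 0 j * b d i j =
  \sum_i \sum_j \sum_k z 0 i * z' 0 j * w 0 k * \sum_e b e j k * b d i e.
Proof.
apply: eq_bigr => a _ /=; under eq_bigr => e _ do rewrite !mxE mulr_sumr mulr_suml.
rewrite exchange_big; apply: eq_bigr => i _ /=.
under eq_bigr => e _ do rewrite mulr_sumr mulr_suml.
rewrite exchange_big; apply: eq_bigr => c _ /=; rewrite mulr_sumr.
by apply: eq_bigr => e _; ring.
Qed.

Lemma is_derive_bil (V : normedModType R) (b : 'I_n -> 'I_n -> 'I_n -> V -> R)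
    (A B : V -> 'rV[R]_n) db dA dB (x v : V) :
  (forall d i j, is_derive x v (b d i j) (db d i j)) ->
  is_derive x v A dA -> is_derive x v B dB ->
  is_derive x v (fun y => bil (fun d i j => b d i j y) (A y) (B y))
    (bil db (A x) (B x) + bil (fun d i j => b d i j x) dA (B x)
     + bil (fun d i j => b d i j x) (A x) dB).
Proof.
move=> Hb /is_derive_mxP HA /is_derive_mxP HB; apply/is_derive_mxP => z d.
rewrite (ord1 z) !mxE -!big_split /=.
under eq_fun do rewrite mxE.
apply: is_derive_sum_fun => i; rewrite -!big_split /=.
apply: is_derive_sum_fun => j.
apply: is_derive_eq (is_derive_mul (is_derive_mul (HA 0 i) (HB 0 j)) (Hb d i j)) _.
by rewrite /=; ring.
Qed.

End Bilinear.

Section QuadraticForm.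
Context {R : realType} {n : nat}.
Implicit Types (A B : 'M[R]_n) (u v : 'rV[R]_n).

Definition qf A u v : R := (u *m A *m v^T) 0 0.

Lemma qf_def A u v : (u *m A *m v^T) 0 0 = qf A u v.
Proof. by []. Qed.

Lemma qfE A u v : qf A u v = \sum_i \sum_j u 0 i * v 0 j * A i j.
Proof.
rewrite /qf mxE exchange_big; apply: eq_bigr => j _ /=.
rewrite !mxE mulr_suml; apply: eq_bigr => i _; rewrite mulrAC; ring.
Qed.

Lemma qfC A u v : A^T = A -> qf A u v = qf A v u.
Proof.
move=> AT; rewrite !qfE exchange_big.
apply: eq_bigr => k _; apply: eq_bigr => l _.
by rewrite -[in LHS]AT mxE [u 0 l * _]mulrC.
Qed.

Lemma qf_row A u v : qf A u v = \sum_j (u *m A) 0 j * v 0 j.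
Proof. by rewrite /qf mxE; apply: eq_bigr => j _; rewrite [v^T _ _]mxE. Qed.

Lemma qfDl A u u' v : qf A (u + u') v = qf A u v + qf A u' v.
Proof. by rewrite /qf !mulmxDl mxE. Qed.

Lemma qfZl A c u v : qf A (c *: u) v = c * qf A u v.
Proof. by rewrite /qf -!scalemxAl mxE. Qed.

Lemma qfBl A u u' v : qf A (u - u') v = qf A u v - qf A u' v.
Proof. by rewrite qfDl -scaleN1r qfZl mulN1r. Qed.

Lemma qfDr A u v v' : qf A u (v + v') = qf A u v + qf A u v'.
Proof. by rewrite /qf linearD mulmxDr mxE. Qed.

Lemma qfZr A c u v : qf A u (c *: v) = c * qf A u v.
Proof. by rewrite /qf linearZ -scalemxAr mxE. Qed.

Lemma qfBr A u v v' : qf A u (v - v') = qf A u v - qf A u v'.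
Proof. by rewrite qfDr -scaleN1r qfZr mulN1r. Qed.

Lemma qf0l A v : qf A 0 v = 0.
Proof. by rewrite -[X in qf A X](scale0r v) qfZl mul0r. Qed.

Lemma qf0r A v : qf A v 0 = 0.
Proof. by rewrite -[X in qf A _ X](scale0r v) qfZr mul0r. Qed.

Lemma qf_congr A B u v : qf (B *m A *m B^T) u v = qf A (u *m B) (v *m B).
Proof. by rewrite /qf trmx_mul !mulmxA. Qed.

Lemma is_derive_qf (V : normedModType R) (A : V -> 'M[R]_n) (u v : V -> 'rV[R]_n)
    dA du dv (x z : V) :
  is_derive x z A dA -> is_derive x z u du -> is_derive x z v dv ->
  is_derive x z (fun y => qf (A y) (u y) (v y))
    (qf dA (u x) (v x) + qf (A x) du (v x) + qf (A x) (u x) dv).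
Proof.
move=> HA Hu Hv.
have H := is_derive_mulmx (is_derive_mulmx Hu HA) (is_derive_trmx Hv).
apply: is_derive_eq ((is_derive_mxP _ _ _ _).1 H 0 0) _.
by rewrite mulmxDl mxE [X in X + _ = _]mxE /qf [X in X + _]addrC.
Qed.

End QuadraticForm.

Local Opaque derive qf.

(** * Christoffel symbols, the Koszul formula and skewness of the curvature *)

Section LeviCivita.
Context {R : realType} {n : nat} (U : set 'rV[R]_n) (oU : open U).
Variable g : 'rV[R]_n -> 'M[R]_n.
Hypothesis Cg : forall k, Cmx U k g.
Hypothesis gT : forall x, U x -> (g x)^T = g x.
Hypothesis gU : forall x, U x -> g x \in unitmx.
Implicit Types (x u v w : 'rV[R]_n).

Definition Gam x : 'I_n -> 'I_n -> 'I_n -> R := fun c a b => christoffel g c a b x.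

(** Twice the Christoffel symbol of the first kind. *)
Definition koszul_coef x (a b d : 'I_n) : R :=
  partial a (fun y => g y b d) x + partial b (fun y => g y a d) x
  - partial d (fun y => g y a b) x.

Lemma christoffel_Ck k c a b : Ck k U (christoffel g c a b).
Proof.
have Cp e i j : Ck k U (partial e (fun y => g y i j)) by apply: Ck_partial; exact: Cg.
apply: CkM => //; first exact: Ck_cst.
apply: Ck_sum => // d _; apply: CkM => //.
  exact: (Cmx_inv oU gU (Cg k)).
by apply: CkB => //; exact: CkD.
Qed.

Lemma partial_gC x e a b : U x ->
  partial e (fun y => g y a b) x = partial e (fun y => g y b a) x.
Proof.
move=> Ux; apply: near_eq_derive; apply: filterS (near_in oU Ux) => y Uy.
by rewrite -[in LHS](gT Uy) mxE.
Qed.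

Lemma christoffelC x c a b : U x -> christoffel g c a b x = christoffel g c b a x.
Proof.
move=> Ux; rewrite /christoffel; congr (_ * _); apply: eq_bigr => d _.
by rewrite (partial_gC d a b Ux) [X in _ * (X - _)]addrC.
Qed.

Lemma GamC x u v : U x -> bil (Gam x) u v = bil (Gam x) v u.
Proof. by move=> Ux; apply: bilC => d i j; exact: christoffelC. Qed.

(** Lowering the index cancels the inverse metric in [christoffel], which leaves only first
    derivatives of [g]. *)
Lemma Gam_lower x u v : U x ->
  bil (Gam x) u v *m g x =
  \row_d (2^-1 * \sum_i \sum_j u 0 i * v 0 j * koszul_coef x i j d).
Proof.
move=> Ux; set K := RHS.
have -> : bil (Gam x) u v = K *m (invmx (g x))^T.
  apply/rowP => c; rewrite !mxE.
  under [RHS]eq_bigr => d _ do rewrite !mxE mulrAC mulr_sumr.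
  rewrite [RHS]exchange_big; apply: eq_bigr => i _ /=.
  under [RHS]eq_bigr => d _ do rewrite mulr_sumr.
  rewrite [RHS]exchange_big; apply: eq_bigr => j _ /=.
  rewrite /Gam /christoffel mulrA mulr_sumr; apply: eq_bigr => d _.
  by rewrite /koszul_coef; ring.
rewrite -mulmxA -{2}(gT Ux) -trmx_mul -[in X in (X *m _)^T](gT Ux).
by rewrite (gT Ux) mulmxV ?gU // trmx1 mulmx1.
Qed.

Lemma derive_gE x u v w : U x -> qf ('D_u g x) v w =
  \sum_i \sum_j \sum_d u 0 i * v 0 j * w 0 d * partial i (fun y => g y j d) x.
Proof.
move=> Ux; rewrite qfE.
have E j d : 'D_u g x j d = \sum_a u 0 a * partial a (fun y => g y j d) x.
  by rewrite (Cmx_deriveE oU u j d (Cg 1) Ux); exact: (Ck_deriveE oU u (Cg 1 j d) Ux).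
rewrite -sum3_swap; apply: eq_bigr => j _; apply: eq_bigr => d _; by rewrite E.
Qed.

(** The Koszul formula for constant vector fields, whose brackets vanish. It characterizes Gamma
    without the inverse of [g], so that later identities can be tested by pairing with vectors. *)
Lemma koszul x u v w : U x ->
  qf (g x) (bil (Gam x) u v) w =
  2^-1 * (qf ('D_u g x) v w + qf ('D_v g x) u w - qf ('D_w g x) u v).
Proof.
move=> Ux; rewrite qf_row Gam_lower //.
have E1 := derive_gE u v w Ux.
have E2 : qf ('D_v g x) u w =
   \sum_i \sum_j \sum_d u 0 i * v 0 j * w 0 d * partial j (fun y => g y i d) x.
  rewrite derive_gE // exchange_big; apply: eq_bigr => i _; apply: eq_bigr => j _.
  by apply: eq_bigr => d _; rewrite [v 0 j * _]mulrC.
have E3 : qf ('D_w g x) u v =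
   \sum_i \sum_j \sum_d u 0 i * v 0 j * w 0 d * partial d (fun y => g y i j) x.
  rewrite derive_gE // exchange_big; apply: eq_bigr => i _; rewrite exchange_big.
  apply: eq_bigr => j _; apply: eq_bigr => d _ /=; ring.
rewrite E1 E2 E3 -big_split -sumrB mulr_sumr.
under eq_bigr => d _ do rewrite !mxE mulrAC mulr_sumr.
rewrite exchange_big; apply: eq_bigr => i _ /=.
under eq_bigr => d _ do rewrite mulr_sumr.
rewrite -big_split -sumrB mulr_sumr exchange_big; apply: eq_bigr => j _ /=.
rewrite -big_split -sumrB mulr_sumr; apply: eq_bigr => d _ /=.
rewrite /koszul_coef; ring.
Qed.

(** The expression in [curvature], for an arbitrary metric in coordinates. *)
Definition Rm x u v w : 'rV[R]_n := \row_d \sum_a \sum_b \sum_c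
  u 0 a * v 0 b * w 0 c * riemann g a b c d x.

Lemma is_derive_Gam x u v w : U x ->
  is_derive x u (fun y => bil (Gam y) v w)
    (bil (fun d i j => 'D_u (christoffel g d i j) x) v w).
Proof.
move=> Ux.
have Hb d i j : is_derive x u (christoffel g d i j) ('D_u (christoffel g d i j) x).
  exact/derivableP/diff_derivable/(Ck_differentiable oU (christoffel_Ck 1 d i j) Ux).
apply: is_derive_eq (is_derive_bil Hb (is_derive_cst v x u) (is_derive_cst w x u)) _.
by rewrite bil0l bil0r !addr0.
Qed.

(** Constant extensions of [u], [v], [w] have vanishing brackets, and Gamma gives their covariant
    derivatives; this is the commutator of the two covariant derivatives written out. *)
Lemma RmE x u v w : U x ->
  Rm x u v w =
  'D_u (fun y => bil (Gam y) v w) x - 'D_v (fun y => bil (Gam y) u w) x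
  + bil (Gam x) u (bil (Gam x) v w) - bil (Gam x) v (bil (Gam x) u w).
Proof.
move=> Ux; have [_ ->] := is_derive_Gam u v w Ux; have [_ ->] := is_derive_Gam v u w Ux.
apply/rowP => d; rewrite !mxE.
have DE z i j : 'D_z (christoffel g d i j) x = \sum_a z 0 a * partial a (christoffel g d i j) x.
  exact: (Ck_deriveE oU z (christoffel_Ck 1 d i j) Ux).
(* [T] contracts three indices with [u], [v], [w]; two of the four sums take this form only after
   their first two indices are exchanged. *)
pose T (f : 'I_n -> 'I_n -> 'I_n -> R) :=
  \sum_a \sum_b \sum_c u 0 a * v 0 b * w 0 c * f a b c.
have D (z z' : 'rV[R]_n) : \sum_i \sum_j z 0 i * w 0 j * 'D_z' (christoffel g d i j) x =
    \sum_a \sum_b \sum_c z' 0 a * z 0 b * w 0 c * partial a (christoffel g d b c) x.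
  rewrite -sum3_swap; apply: eq_bigr => i _; apply: eq_bigr => j _.
  by rewrite DE.
have E1 : \sum_i \sum_j v 0 i * w 0 j * 'D_u (christoffel g d i j) x =
    T (fun a b c => partial a (christoffel g d b c) x) by exact: D.
have E2 : \sum_i \sum_j u 0 i * w 0 j * 'D_v (christoffel g d i j) x =
    T (fun a b c => partial b (christoffel g d a c) x).
  rewrite D exchange_big; apply: eq_bigr => a _; apply: eq_bigr => b _.
  by apply: eq_bigr => c _; rewrite [v 0 b * _]mulrC.
have E (z z' : 'rV[R]_n) : \sum_i \sum_j z 0 i * bil (Gam x) z' w 0 j * Gam x d i j =
  \sum_a \sum_b \sum_c z 0 a * z' 0 b * w 0 c *
     \sum_e christoffel g e b c x * christoffel g d a e x by exact: sum_bil_bil.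
have E4 : \sum_i \sum_j v 0 i * bil (Gam x) u w 0 j * Gam x d i j =
    T (fun a b c => \sum_e christoffel g e a c x * christoffel g d b e x).
  rewrite E exchange_big; apply: eq_bigr => a _; apply: eq_bigr => b _.
  by apply: eq_bigr => c _; rewrite [v 0 b * _]mulrC.
have TB f h : T f - T h = T (fun a b c => f a b c - h a b c).
  rewrite /T -sumrB; apply: eq_bigr => a _; rewrite -sumrB; apply: eq_bigr => b _.
  by rewrite -sumrB; apply: eq_bigr => c _; rewrite mulrBr.
have TD f h : T f + T h = T (fun a b c => f a b c + h a b c).
  rewrite /T -big_split; apply: eq_bigr => a _; rewrite -big_split; apply: eq_bigr => b _.
  by rewrite -big_split; apply: eq_bigr => c _; rewrite mulrDr.
apply: (@etrans _ _ (T (fun a b c => partial a (christoffel g d b c) x)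
   - T (fun a b c => partial b (christoffel g d a c) x)
   + T (fun a b c => \sum_e christoffel g e b c x * christoffel g d a e x)
   - T (fun a b c => \sum_e christoffel g e a c x * christoffel g d b e x))).
  rewrite TB TD TB; apply: eq_bigr => a _; apply: eq_bigr => b _; apply: eq_bigr => c _.
  by rewrite /riemann sumrB [in LHS]addrA.
have alg (r1 r2 r3 r4 s1 s2 s3 s4 : R) : s1 = r1 -> s2 = r2 -> s3 = r3 -> s4 = r4 ->
  r1 - r2 + r3 - r4 = s1 - s2 + s3 - s4 by move=> -> -> -> ->.
exact: (alg _ _ _ _ _ _ _ _ E1 E2 (E u v) E4).
Qed.

Lemma Rmuu x u w : U x -> Rm x u u w = 0.
Proof. by move=> Ux; rewrite RmE // subrr add0r subrr. Qed.

Lemma RmD2 x u v v' w : Rm x u (v + v') w = Rm x u v w + Rm x u v' w.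
Proof.
apply/rowP => d; rewrite !mxE -big_split; apply: eq_bigr => a _ /=.
rewrite -big_split; apply: eq_bigr => b _ /=; rewrite -big_split; apply: eq_bigr => c _ /=.
rewrite !mxE; ring.
Qed.

Lemma RmD3 x u v w w' : Rm x u v (w + w') = Rm x u v w + Rm x u v w'.
Proof.
apply/rowP => d; rewrite !mxE -big_split; apply: eq_bigr => a _ /=.
rewrite -big_split; apply: eq_bigr => b _ /=; rewrite -big_split; apply: eq_bigr => c _ /=.
rewrite !mxE; ring.
Qed.

Lemma RmZ2 x u k v w : Rm x u (k *: v) w = k *: Rm x u v w.
Proof.
apply/rowP => d; rewrite !mxE mulr_sumr; apply: eq_bigr => a _ /=.
rewrite mulr_sumr; apply: eq_bigr => b _ /=; rewrite mulr_sumr; apply: eq_bigr => c _ /=.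
rewrite !mxE; ring.
Qed.

Lemma RmZ3 x u v k w : Rm x u v (k *: w) = k *: Rm x u v w.
Proof.
apply/rowP => d; rewrite !mxE mulr_sumr; apply: eq_bigr => a _ /=.
rewrite mulr_sumr; apply: eq_bigr => b _ /=; rewrite mulr_sumr; apply: eq_bigr => c _ /=.
rewrite !mxE; ring.
Qed.

Lemma derive_gT x u : U x -> ('D_u g x)^T = 'D_u g x.
Proof.
move=> Ux; apply/matrixP => i j; rewrite mxE !(Cmx_deriveE oU u _ _ (Cg 1) Ux).
apply: near_eq_derive; apply: filterS (near_in oU Ux) => y Uy.
by rewrite -[in LHS](gT Uy) mxE.
Qed.

(** The connection is metric: when the two Koszul formulas are added, all terms but the derivative
    of [g] along [b] cancel. *)
Lemma metric_compat x b v w : U x ->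
  qf ('D_b g x) v w =
  qf (g x) (bil (Gam x) b v) w + qf (g x) (bil (Gam x) b w) v.
Proof.
move=> Ux; rewrite !koszul // (qfC w v (derive_gT b Ux)).
have half (a c d : R) : a = 2^-1 * (a + c - d) + 2^-1 * (a + d - c) by field.
exact: half.
Qed.

(** When the vector paired with is also the second argument of Gamma, the Koszul formula collapses
    to half the derivative of g(w, w) along [v]; differentiating this along [u] gives the
    identity. *)
Lemma derive_Gam_lower x u v w : U x ->
  qf (g x) ('D_u (fun y => bil (Gam y) v w) x) w =
  2^-1 * qf ('D_u ('D_v g) x) w w - qf ('D_u g x) (bil (Gam x) v w) w.
Proof.
move=> Ux.
have [dG _] := is_derive_Gam u v w Ux; have DG := derivableP dG.
have Dg := Cmx_is_derive oU u (Cg 1) Ux.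
have cw : is_derive x u (fun=> w) 0 by exact: is_derive_cst.
have DL := is_derive_qf Dg DG cw.
have Dg2 := Cmx_is_derive oU u (Cmx_derive oU v (Cg 2)) Ux.
have DR := is_derive_qf Dg2 cw cw.
have := near_eq_is_derive _ DL.
have E : \forall y \near x, qf (g y) (bil (Gam y) v w) w = 2^-1 * qf ('D_v g y) w w.
  by apply: filterS (near_in oU Ux) => y Uy; rewrite koszul // addrK.
move=> /(_ _ E) [_].
case: DR => dR E2; rewrite deriveMl // E2 !qf0l !qf0r !addr0 => ->.
by rewrite [qf ('D_u g x) _ _ + _]addrC addrK.
Qed.

(** The second derivatives of g(w, w) cancel by Schwarz's theorem, metric compatibility removes the
    terms Gamma(u, Gamma(v, w)) and Gamma(v, Gamma(u, w)), and the remaining product of Gamma(u, w)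
    with Gamma(v, w) is symmetric in [u] and [v], so it cancels too. *)
Lemma Rm_skew x u v w : U x -> qf (g x) (Rm x u v w) w = 0.
Proof.
move=> Ux; rewrite RmE // qfBl qfDl qfBl.
rewrite (derive_Gam_lower u v w Ux) (derive_Gam_lower v u w Ux).
rewrite (metric_compat u (bil (Gam x) v w) w Ux) (metric_compat v (bil (Gam x) u w) w Ux).
rewrite (Cmx_deriveC oU u v (Cg 2) Ux).
rewrite (qfC (bil (Gam x) u w) (bil (Gam x) v w) (gT Ux)); ring.
Qed.

End LeviCivita.

Lemma is_derive_comp_Ck (R : realType) n m (U : set 'rV[R]_n) (V : set 'rV[R]_m)
    (phi : 'rV[R]_n -> 'rV[R]_m) (f : 'rV[R]_m -> R) k l x u :
  open U -> open V -> Cmx U k.+1 phi -> Ck l.+1 V f -> U x -> V (phi x) ->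
  is_derive x u (f \o phi) ('D_('D_u phi x) f (phi x)).
Proof.
move=> oU oV Cphi CH Ux Vx.
have dphi := Cmx_differentiable oU Cphi Ux.
have dH := Ck_differentiable oV CH Vx.
have dc : differentiable (f \o phi : _ -> R^o) x by exact: differentiable_comp.
split; first exact: diff_derivable.
by rewrite (deriveE _ dc) diff_comp // (deriveE _ dphi) deriveE.
Qed.

(** * Change of charts *)

Section Tensor.
Context {R : realType} {n : nat} (U V : set 'rV[R]_n) (oU : open U) (oV : open V).
Variables (g h : 'rV[R]_n -> 'M[R]_n) (phi : 'rV[R]_n -> 'rV[R]_n).
Hypothesis Cg : forall k, Cmx U k g.
Hypothesis gT : forall x, U x -> (g x)^T = g x.
Hypothesis gU : forall x, U x -> g x \in unitmx.
Hypothesis Ch : forall k, Cmx V k h.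
Hypothesis hT : forall x, V x -> (h x)^T = h x.
Hypothesis hU : forall x, V x -> h x \in unitmx.
Hypothesis Cphi : forall k, Cmx U k phi.
Hypothesis phiV : forall x, U x -> V (phi x).
Hypothesis gE : forall x, U x -> g x = 'J phi x *m h (phi x) *m ('J phi x)^T.
Implicit Types (x u v w : 'rV[R]_n).

Local Notation J := (jacobian phi).

Lemma jacE x u : U x -> 'D_u phi x = u *m J x.
Proof. by move=> Ux; apply/deriveEjacobian/(Cmx_differentiable oU (Cphi 1) Ux). Qed.

(** The invertible matrix [g x] factors through the Jacobian, so no inverse of [phi] has to be
    differentiated. *)
Lemma jac_unit x : U x -> J x \in unitmx.
Proof.
move=> Ux; have := gU Ux.
by rewrite gE // !unitmx_mul unitmx_tr => /andP[/andP[]].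
Qed.

Lemma qf_jac x v w : U x -> qf (g x) v w = qf (h (phi x)) ('D_v phi x) ('D_w phi x).
Proof. by move=> Ux; rewrite gE // qf_congr !jacE. Qed.

Lemma Cmx_jac k : Cmx U k J.
Proof.
move=> i j; apply: Ck_congr (Cmx_derive oU (delta_mx 0 i) (Cphi k.+1) 0 j) => // x.
by rewrite inE => Ux; rewrite jacE // -rowE mxE.
Qed.

Lemma hess_jac x c w : U x -> 'D_w ('D_c phi) x = c *m 'D_w J x.
Proof.
move=> Ux.
have DJ := Cmx_is_derive oU w (Cmx_jac 1) Ux.
have Dl := is_derive_mulmx (is_derive_cst c x w) DJ.
have E : \forall y \near x, cst c y *m J y = 'D_c phi y.
  by apply: filterS (near_in oU Ux) => y Uy; rewrite jacE.
have [_ ->] := near_eq_is_derive E Dl.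
by rewrite mul0mx add0r.
Qed.

Lemma hessC x u v : U x -> 'D_u ('D_v phi) x = 'D_v ('D_u phi) x.
Proof. exact: (Cmx_deriveC oU u v (Cphi 2)). Qed.

Lemma is_derive_hess x u v : U x -> is_derive x u ('D_v phi) ('D_u ('D_v phi) x).
Proof. by move=> Ux; exact: (Cmx_is_derive oU u (Cmx_derive oU v (Cphi 2)) Ux). Qed.

Lemma derive_pullback x u v w : U x ->
  qf ('D_u g x) v w =
  qf ('D_('D_u phi x) h (phi x)) ('D_v phi x) ('D_w phi x)
  + qf (h (phi x)) ('D_u ('D_v phi) x) ('D_w phi x)
  + qf (h (phi x)) ('D_v phi x) ('D_u ('D_w phi) x).
Proof.
move=> Ux.
have Dl := is_derive_qf (Cmx_is_derive oU u (Cg 1) Ux) (is_derive_cst v x u) (is_derive_cst w x u).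
have Dh := is_derive_comp_Cmx u oU oV (Cphi 1) (Ch 1) Ux (phiV Ux).
have Dr := is_derive_qf Dh (is_derive_hess u v Ux) (is_derive_hess u w Ux).
have E : \forall y \near x, qf (g y) (cst v y) (cst w y) = qf ((h \o phi) y) ('D_v phi y) ('D_w phi y).
  by apply: filterS (near_in oU Ux) => y Uy; exact: qf_jac.
have [_ E1] := near_eq_is_derive E Dl; have [_ E2] := Dr.
by rewrite E1 qf0l qf0r !addr0 in E2.
Qed.

(** As the Jacobian is invertible, the vectors ['D_w phi x] exhaust the space; identities between
    vectors can thus be tested by pairing with them. *)
Lemma qf_nondeg x z : U x ->
  (forall w, qf (h (phi x)) z ('D_w phi x) = 0) -> z = 0.
Proof.
move=> Ux H; have Ju := jac_unit Ux; have hu := hU (phiV Ux).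
have E : z *m (h (phi x) *m (J x)^T) = 0.
  apply/rowP => k; rewrite [RHS]mxE -(H (delta_mx 0 k)) -qf_def jacE //.
  by rewrite [in RHS]trmx_mul !mulmxA trmx_delta -colE [RHS]mxE.
by rewrite -[z](@mulmxK _ _ _ (h (phi x) *m (J x)^T)) ?E ?mul0mx // unitmx_mul hu unitmx_tr.
Qed.

(** Both connections obey a Koszul formula, so the two sides are compared after pairing with
    ['D_w phi x]. Differentiating the pulled back metric produces six terms with second derivatives
    of [phi]: four of them cancel in pairs, and the other two are equal and form the inhomogeneous
    term. *)
Lemma Gam_transform x u v : U x ->
  'D_(bil (Gam g x) u v) phi x =
  bil (Gam h (phi x)) ('D_u phi x) ('D_v phi x) + 'D_u ('D_v phi) x.
Proof.
move=> Ux; apply/eqP; rewrite -subr_eq0; apply/eqP; apply: (qf_nondeg Ux) => w.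
rewrite qfBl qfDl -(qf_jac _ _ Ux).
have hs := hT (phiV Ux).
have alg (L K a1 a2 a3 b1 b2 b3 c1 d1 c2 d2 c3 d3 : R) :
    L = 2^-1 * (a1 + a2 - a3) -> K = 2^-1 * (b1 + b2 - b3) ->
    a1 = b1 + c1 + d1 -> a2 = b2 + c2 + d2 -> a3 = b3 + c3 + d3 ->
    c2 = c1 -> d1 = c3 -> d2 = d3 -> L - (K + c1) = 0.
  by move=> -> -> -> -> -> -> -> ->; field.
apply: (alg _ _ _ _ _ _ _ _ _ _ _ _ _ _ (koszul oU Cg gT gU u v w Ux)
  (koszul oV Ch hT hU _ _ _ (phiV Ux)) (derive_pullback u v w Ux)
  (derive_pullback v u w Ux) (derive_pullback w u v Ux)).
- exact: (congr1 (fun z => qf (h (phi x)) z ('D_w phi x)) (hessC v u Ux)).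
- apply: etrans (qfC _ _ hs) _.
  exact: (congr1 (fun z => qf (h (phi x)) z ('D_v phi x)) (hessC u w Ux)).
- exact: (congr1 (fun z => qf (h (phi x)) ('D_u phi x) z) (hessC v w Ux)).
Qed.

(** The transformation law differentiated along [w] with [a], [b] fixed. The second summand on the
    left comes from the derivative of the Jacobian, applied to Gamma(a, b) frozen at [x]. *)
Lemma is_derive_Gam_transform x a b w : U x ->
  'D_w (fun y => bil (Gam g y) a b) x *m J x + 'D_w ('D_(bil (Gam g x) a b) phi) x =
  'D_('D_w phi x) (fun y => bil (Gam h y) ('D_a phi x) ('D_b phi x)) (phi x)
  + bil (Gam h (phi x)) ('D_w ('D_a phi) x) ('D_b phi x)
  + bil (Gam h (phi x)) ('D_a phi x) ('D_w ('D_b phi) x)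
  + 'D_w ('D_a ('D_b phi)) x.
Proof.
move=> Ux; rewrite hess_jac //.
have [dG _] := is_derive_Gam oU Cg gU w a b Ux.
have Dl := is_derive_mulmx (derivableP dG) (Cmx_is_derive oU w (Cmx_jac 1) Ux).
have [_ ->] := is_derive_Gam oV Ch hU ('D_w phi x) ('D_a phi x) ('D_b phi x) (phiV Ux).
have Hb d i j := is_derive_comp_Ck w oU oV (Cphi 1) (christoffel_Ck oV Ch hU 1 d i j) Ux (phiV Ux).
have Db := is_derive_bil Hb (is_derive_hess w a Ux) (is_derive_hess w b Ux).
have Dt := Cmx_is_derive oU w (Cmx_derive oU a (Cmx_derive oU b (Cphi 3))) Ux.
have Dr := is_deriveD Db Dt.
have E : \forall y \near x, bil (Gam g y) a b *m J y =
    bil (fun d i j => (christoffel h d i j \o phi) y) ('D_a phi y) ('D_b phi y)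
    + 'D_a ('D_b phi) y.
  by apply: filterS (near_in oU Ux) => y Uy; rewrite -jacE // Gam_transform.
have [_ E1] := near_eq_is_derive E Dl; have [_ E2] := Dr.
by rewrite -E1; exact: E2.
Qed.

(* Differentiating [Gam_transform] along phi and antisymmetrizing, the third
   derivatives of phi cancel by Schwarz's theorem. *)
Lemma Rm_tensor x u v : U x ->
  Rm g x u v v *m J x = Rm h (phi x) (u *m J x) (v *m J x) (v *m J x).
Proof.
move=> Ux.
rewrite (RmE oU Cg gU u v v Ux) (RmE oV Ch hU _ _ _ (phiV Ux)).
rewrite mulmxBl mulmxDl mulmxBl -(jacE u Ux) -(jacE v Ux).
(* Here [t], [t'] are third derivatives of [phi], and [p], [q] are second derivatives of [phi]
   involving the directions Gamma(v, v) and Gamma(u, v); [p] and [q] occur once in a differentiated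
   law and once in a plain one, and drop out. *)
have alg (x1 x2 x3 x4 p q d1 d2 a1 a2 a3 a4 c t t' b1 b2 B1 B2 : 'rV[R]_n) :
    x1 + p = d1 + a1 + a2 + t -> x2 + q = d2 + a3 + c + t' ->
    x3 = b1 + p -> x4 = b2 + q -> b1 = B1 + c -> b2 = B2 + a4 ->
    a2 = a1 -> a3 = a1 -> a4 = a1 -> t' = t ->
    x1 - x2 + x3 - x4 = d1 - d2 + B1 - B2.
  move=> H1 H2 -> -> -> -> e2 e3 e4 e5; subst.
  have -> : x1 = d1 + a1 + a1 + t - p by rewrite -H1 addrK.
  have -> : x2 = d2 + a1 + c + t - q by rewrite -H2 addrK.
  apply/rowP => k; rewrite !mxE; ring.
have Vx := phiV Ux.
apply: (alg _ _ _ _ _ _ _ _ _ _ _ _ _ _ _ _ _ _ _ (is_derive_Gam_transform v v u Ux)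
  (is_derive_Gam_transform u v v Ux)
  (etrans (esym (jacE _ Ux)) (Gam_transform u (bil (Gam g x) v v) Ux))
  (etrans (esym (jacE _ Ux)) (Gam_transform v (bil (Gam g x) u v) Ux))
  (etrans (congr1 (bil (Gam h (phi x)) ('D_u phi x)) (Gam_transform v v Ux)) (bilDr _ _ _ _))
  (etrans (congr1 (bil (Gam h (phi x)) ('D_v phi x)) (Gam_transform u v Ux)) (bilDr _ _ _ _))).
- exact: (GamC oV hT _ _ Vx).
- exact: (congr1 (fun z => bil (Gam h (phi x)) z ('D_v phi x)) (hessC v u Ux)).
- exact: (GamC oV hT _ _ Vx).
- exact: (Cmx_deriveC oU v u (Cmx_derive oU v (Cphi 3)) Ux).
Qed.

End Tensor.


(** * Local lower bounds for the sectional curvature *)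

Section NormBounds.
Context {R : realType} {n : nat}.
Implicit Types (u v w : 'rV[R]_n).

Lemma sum_ord_cst m (x : R) : \sum_(i < m) x = m%:R * x.
Proof. by rewrite sumr_const card_ord mulr_natl. Qed.

Lemma qf_le (A : 'M[R]_n) (C : R) u v : 0 <= C -> (forall i j, `|A i j| <= C) ->
  `|qf A u v| <= n%:R ^+ 2 * C * `|u| * `|v|.
Proof.
move=> C0 AC; rewrite qfE; apply: le_trans (ler_norm_sum _ _ _) _.
have -> : n%:R ^+ 2 * C * `|u| * `|v| = \sum_(i < n) (\sum_(j < n) (C * `|u| * `|v|)).
  by rewrite !sum_ord_cst; ring.
apply: ler_sum => i _; apply: le_trans (ler_norm_sum _ _ _) _.
apply: ler_sum => j _; rewrite !normrM mulrC -mulrA.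
by apply: ler_pM => //; apply: ler_pM => //; exact: norm_coord_le.
Qed.

Lemma Rm_le (g : 'rV[R]_n -> 'M[R]_n) x (C : R) u v w :
  0 <= C -> (forall a b c d, `|riemann g a b c d x| <= C) ->
  `|Rm g x u v w| <= n%:R ^+ 3 * C * `|u| * `|v| * `|w|.
Proof.
move=> C0 HC; apply: norm_row_le.
  by rewrite !mulr_ge0 // exprn_ge0.
move=> d; rewrite mxE.
have -> : n%:R ^+ 3 * C * `|u| * `|v| * `|w| =
    \sum_(i < n) (\sum_(j < n) (\sum_(k < n) (`|u| * `|v| * `|w| * C))).
  by rewrite !sum_ord_cst; ring.
apply: le_trans (ler_norm_sum _ _ _) _; apply: ler_sum => i _.
apply: le_trans (ler_norm_sum _ _ _) _; apply: ler_sum => j _.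
apply: le_trans (ler_norm_sum _ _ _) _; apply: ler_sum => k _.
rewrite !normrM; apply: ler_pM => //.
apply: ler_pM; rewrite ?mulr_ge0 //; last exact: norm_coord_le.
by apply: ler_pM => //; exact: norm_coord_le.
Qed.

End NormBounds.

Lemma near_bounded (R : realType) (T : topologicalType) (I : finType) (f : I -> T -> R) (x : T) :
  (forall i, f i y @[y --> x] --> f i x) ->
  exists2 C : R, 0 <= C & \forall y \near x, forall i, `|f i y| <= C.
Proof.
move=> cf; exists (\sum_i (`|f i x| + 1)).
  by apply: sumr_ge0 => i _; exact: addr_ge0.
apply: filter_forall => i; have /cvgrPdist_le /(_ 1 ltr01) := cf i.
apply: filterS => y fy; rewrite (bigD1 i) //= -[leLHS]addr0; apply: lerD.
  by rewrite -lerBlDl (le_trans _ fy) // distrC lerB_dist.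
by apply: sumr_ge0 => j _; exact: addr_ge0.
Qed.

(** * Curvature near a point in one chart *)

Section PointBound.
Context {R : realType} {n : nat} (U : set 'rV[R]_n) (oU : open U).
Variable g : 'rV[R]_n -> 'M[R]_n.
Hypothesis Cg : forall k, Cmx U k g.
Hypothesis gT : forall x, U x -> (g x)^T = g x.
Hypothesis gP : forall x, U x -> forall v, v != 0 -> 0 < qf (g x) v v.
Implicit Types (x u v w : 'rV[R]_n).

Lemma posdef_unit x : U x -> g x \in unitmx.
Proof.
move=> Ux; rewrite -row_free_unit; apply/row_freeP.
suff /row_freeP : row_free (g x) by [].
rewrite -kermx_eq0; apply/negPn/negP => /rowV0Pn [v vK v0].
have := gP Ux v0; rewrite qf_row.
have -> : v *m g x = 0 by apply/sub_kermxP.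
by rewrite big1 ?ltxx // => j _; rewrite mxE mul0r.
Qed.

(* Skewness allows v to be replaced by its component orthogonal to u, for which the
   denominator is comparable with |u|^2 |v|^2. *)
Lemma sectional_num_ge x (lam C : R) u v : U x -> 0 < lam -> 0 <= C ->
  (forall v, lam * `|v| ^+ 2 <= qf (g x) v v) ->
  (forall a b c d, `|riemann g a b c d x| <= C) ->
  (forall a b, `|g x a b| <= C) ->
  let den := qf (g x) u u * qf (g x) v v - qf (g x) u v ^+ 2 in
  0 <= den /\ - (n%:R ^+ 5 * C ^+ 2 / lam ^+ 2) * den <= qf (g x) (Rm g x u v v) u.
Proof.
move=> Ux lam0 C0 Hl HR Hg den.
have gu := posdef_unit.
have [u0|u0] := eqVneq u 0.
  have -> : den = 0 by rewrite /den u0 !qf0l; ring.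
  by rewrite u0 qf0r mulr0 lexx.
have quu := gP Ux u0.
pose mu := qf (g x) u v / qf (g x) u u.
pose v' := v - mu *: u.
have vE : v = v' + mu *: u by rewrite subrK.
have orth : qf (g x) u v' = 0.
  by rewrite /v' qfBr qfZr /mu divfK ?subrr // gt_eqF.
have RE : qf (g x) (Rm g x u v v) u = qf (g x) (Rm g x u v' v') u.
  have E z k : qf (g x) (Rm g x u (z + k *: u) (z + k *: u)) u = qf (g x) (Rm g x u z z) u.
    rewrite RmD2 RmZ2 (Rmuu oU Cg gu _ _ Ux) scaler0 addr0 RmD3 RmZ3.
    by rewrite qfDl qfZl (Rm_skew oU Cg gT gu _ _ _ Ux) mulr0 addr0.
  exact: etrans (congr1 (fun z => qf (g x) (Rm g x u z z) u) vE) (E v' mu).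
have denE : den = qf (g x) u u * qf (g x) v' v'.
  have E z k : qf (g x) u z = 0 -> qf (g x) u u * qf (g x) (z + k *: u) (z + k *: u)
      - qf (g x) u (z + k *: u) ^+ 2 = qf (g x) u u * qf (g x) z z.
    by move=> z0; rewrite !(qfDl, qfDr, qfZl, qfZr) (qfC z u (gT Ux)) z0; ring.
  exact: etrans (congr1 (fun z => qf (g x) u u * qf (g x) z z - qf (g x) u z ^+ 2) vE)
    (E v' mu orth).
have den_ge : lam ^+ 2 * (`|u| ^+ 2 * `|v'| ^+ 2) <= den.
  have p0 z : 0 <= lam * `|z : 'rV[R]_n| ^+ 2 by rewrite mulr_ge0 ?exprn_ge0 // ltW.
  by rewrite denE expr2 mulrACA; apply: ler_pM.
have lam2 : 0 < lam ^+ 2 by rewrite exprn_gt0.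
split.
  by apply: le_trans den_ge; rewrite !mulr_ge0 ?exprn_ge0 // ltW.
rewrite RE mulNr lerNl; apply: le_trans (ler_norm _) _; rewrite normrN.
apply: le_trans (qf_le _ _ C0 Hg) _.
(* The metric contributes [n ^ 2 * C] and the curvature tensor [n ^ 3 * C]; the factor [lam ^ 2]
   comes from the lower bound on the denominator. *)
apply: (@le_trans _ _ (n%:R ^+ 5 * C ^+ 2 * (`|u| ^+ 2 * `|v'| ^+ 2))).
  apply: (@le_trans _ _ (n%:R ^+ 2 * C * (n%:R ^+ 3 * C * `|u| * `|v'| * `|v'|) * `|u|)).
    by rewrite ler_wpM2r // ler_wpM2l ?mulr_ge0 ?exprn_ge0 //; exact: Rm_le.
  by rewrite le_eqVlt; apply/orP; left; apply/eqP; ring.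
rewrite -[leRHS]mulrA ler_wpM2l ?mulr_ge0 ?exprn_ge0 //.
by rewrite ler_pdivlMl.
Qed.

(** On the compact unit sphere the form at [x] has a positive minimum [m]; for [y] near [x] the form
    changes by at most [m / 2] there, and homogeneity extends the bound to all vectors. *)
Lemma posdef_near x : U x -> exists2 lam : R, 0 < lam &
  \forall y \near x, forall v, lam * `|v| ^+ 2 <= qf (g y) v v.
Proof.
move=> Ux; pose S := [set v : 'rV[R]_n | `|v| = 1].
have hom (y : 'rV[R]_n) (v : 'rV[R]_n) : v != 0 ->
    qf (g y) v v = `|v| ^+ 2 * qf (g y) (`|v|^-1 *: v) (`|v|^-1 *: v).
  move=> v0; rewrite qfZl qfZr expr2; field.
  by rewrite normr_eq0.
have unitS (v : 'rV[R]_n) : v != 0 -> S (`|v|^-1 *: v).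
  by move=> v0; rewrite /S /= normrZ normfV normr_id mulVf // normr_eq0.
(* The sphere is empty in dimension 0, where the only vector is 0. *)
have [S0|/set0P SN] := eqVneq S set0.
  exists 1 => //; apply: (@filterE _ (nbhs x)) => y v.
  have [->|v0] := eqVneq v 0; first by rewrite normr0 qf0l expr0n mulr0.
  by have := unitS _ v0; rewrite S0.
have cS : compact S.
  apply: bounded_closed_compact.
    by exists 1; split; [exact: num_real|move=> M M1 v /= ->; exact: ltW].
  apply: (@preimage_closed _ _ (fun v : 'rV[R]_n => `|v|) [set 1]); last exact: closed_eq.
  by move=> v _; exact: norm_continuous.
have cq : {within S, continuous (fun v => qf (g x) v v)}.
  apply: continuous_subspaceT => v.
  have -> : (fun v => qf (g x) v v) = (fun v => \sum_i \sum_j v 0 i * v 0 j * g x i j).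
    by apply/funext => z; rewrite qfE.
  apply: (@cvg_sum _ _ _ _ _ (nbhs v)) => i _; apply: (@cvg_sum _ _ _ _ _ (nbhs v)) => j _.
  apply: cvgMr_tmp; apply: cvgM; exact: coord_continuous.
have [c cinS cmin] := EVT_min_rV SN cS cq.
have c0 : c != 0.
  by move: cinS; rewrite inE /S /=; apply: contra_eq_neq => ->; rewrite normr0 eq_sym oner_neq0.
pose m := qf (g x) c c.
have m0 : 0 < m by exact: gP.
exists (m / 2); first by rewrite divr_gt0.
(* Chosen so that an entrywise error [e] changes the form by at most [n ^ 2 * e <= m / 2] on the
   sphere; the summand 1 keeps the divisor positive. *)
pose e := m / 2 / (n%:R ^+ 2 + 1).
have n0 : 0 < n%:R ^+ 2 + 1 :> R by rewrite ltr_wpDl // exprn_ge0.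
have e0 : 0 < e by rewrite !divr_gt0.
have near1 : \forall y \near x, forall i j : 'I_n, `|g x i j - g y i j| <= e.
  apply: (@filter_forall _ _ (fun i y => forall j : 'I_n, `|g x i j - g y i j| <= e) (nbhs x)) => i.
  apply: (@filter_forall _ _ (fun j y => `|g x i j - g y i j| <= e) (nbhs x)) => j.
  have := Ck_continuous (Cg 0 i j) Ux; move/cvgrPdist_le => /(_ _ e0); apply.
apply: filterS near1 => y Hy v.
have [->|v0] := eqVneq v 0; first by rewrite normr0 qf0l expr0n mulr0.
rewrite hom // mulrC ler_wpM2l ?exprn_ge0 //.
set w := _ *: v; have wS : `|w| = 1 by exact: unitS.
have mw : m <= qf (g x) w w by apply: cmin; rewrite inE.
have : `|qf (g x - g y) w w| <= n%:R ^+ 2 * e * `|w| * `|w|.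
  by apply: qf_le => [|i j]; [exact: ltW|rewrite !mxE].
have -> : qf (g x - g y) w w = qf (g x) w w - qf (g y) w w.
  rewrite !qfE -sumrB; apply: eq_bigr => i _; rewrite -sumrB; apply: eq_bigr => j _.
  by rewrite !mxE mulrBr.
rewrite wS !mulr1 => /ler_normlW.
have : n%:R ^+ 2 * e <= m / 2.
  rewrite /e mulrCA; apply: ler_piMr; first by rewrite ltW // divr_gt0.
  by rewrite ler_pdivrMr // mul1r lerDl.
by move: mw; lra.
Qed.

Lemma riemann_Ck k a b c d : Ck k U (riemann g a b c d).
Proof.
have Cc k' c' a' b' := christoffel_Ck oU Cg posdef_unit k' c' a' b'.
apply: CkD => //.
  by apply: CkB => //; apply: Ck_partial; exact: Cc.
by apply: Ck_sum => // e _; apply: CkB => //; apply: CkM => //; exact: Cc.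
Qed.

(** Multiplied out, so as to cover linearly dependent [u], [v] too, for which [den] is 0. *)
Lemma sectional_num_near x : U x -> exists2 C : R, 0 <= C &
  \forall y \near x, forall u v,
    let den := qf (g y) u u * qf (g y) v v - qf (g y) u v ^+ 2 in
    0 <= den /\ - C * den <= qf (g y) (Rm g y u v v) u.
Proof.
move=> Ux; have [lam lam0 Hl] := posdef_near Ux.
pose I := ('I_n * 'I_n * ('I_n * 'I_n))%type.
have [C1 C10 HR] := near_bounded (f := fun i : I => riemann g i.1.1 i.1.2 i.2.1 i.2.2)
  (fun i => Ck_continuous (riemann_Ck 0 i.1.1 i.1.2 i.2.1 i.2.2) Ux).
have [C2 C20 Hg] := near_bounded (f := fun (i : 'I_n * 'I_n) y => g y i.1 i.2)
  (fun i => Ck_continuous (Cg 0 i.1 i.2) Ux).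
pose C := C1 + C2; have C0 : 0 <= C by exact: addr_ge0.
exists (n%:R ^+ 5 * C ^+ 2 / lam ^+ 2).
  by rewrite divr_ge0 ?mulr_ge0 ?exprn_ge0 // ltW.
near=> y => u v; apply: sectional_num_ge => //.
- by near: y; exact: near_in.
- by near: y; exact: Hl.
- move=> a b c d; apply: (@le_trans _ _ C1); last by rewrite lerDl.
  have Hy : forall i : I, `|riemann g i.1.1 i.1.2 i.2.1 i.2.2 y| <= C1 by near: y.
  exact: (Hy ((a, b), (c, d))).
- move=> a b; apply: (@le_trans _ _ C2); last by rewrite lerDr.
  have Hy : forall i : 'I_n * 'I_n, `|g y i.1 i.2| <= C2 by near: y.
  exact: (Hy (a, b)).
Unshelve. all: by end_near. Qed.

End PointBound.

(** * Sectional curvature on the manifold, independently of charts *)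

Section Manifold.
Context {R : realType} {n : nat} {M : riemannianManifold R n}.
Implicit Types (x y : M) (i j : chart_index M).

Definition cod i : set 'rV[R]_n := chart i @` chart_dom i.

Lemma gram_Cmx i k : Cmx (cod i) k (gram i).
Proof. by move=> a b; exact: gram_smooth. Qed.

Lemma gram_posdef i xi : cod i xi -> forall v, v != 0 -> 0 < qf (gram i xi) v v.
Proof. by move=> Ui v v0; exact: gram_pos. Qed.

(** Inside the open set [cod i] the overlap is the preimage of [chart_dom j] under the continuous
    map [chart_inv i]. *)
Lemma overlap_open i j : open (chart i @` (chart_dom i `&` chart_dom j)).
Proof.
rewrite openE => _ [x [xi xj] <-].
have ci : cod i (chart i x) by exists x.
have H1 : \forall z \near chart i x, cod i z.
  by apply: near_in ci; exact: chart_cod_open.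
have H2 : \forall z \near chart i x, chart_dom j (chart_inv i z).
  have cinv : chart_inv i z @[z --> chart i x] --> chart_inv i (chart i x).
    by apply: chart_inv_continuous; rewrite inE.
  rewrite (chartK xi) in cinv; apply: cinv.
  by apply: open_nbhs_nbhs; split => //; exact: chart_dom_open.
apply: filterS2 H1 H2 => _ [z zi <-] zj; exists z => //; split=> //.
by rewrite chartK in zj.
Qed.

Lemma transition_Cmx i j k :
  Cmx (chart i @` (chart_dom i `&` chart_dom j)) k (chart j \o chart_inv i).
Proof. by move=> z l; rewrite (ord1 z); exact: transition_smooth. Qed.

Lemma gram_change i j xi : (chart i @` (chart_dom i `&` chart_dom j)) xi ->
  gram i xi = 'J (chart j \o chart_inv i) xi *m gram j ((chart j \o chart_inv i) xi)
    *m ('J (chart j \o chart_inv i) xi)^T.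
Proof. by move=> [x [xi' xj] <-]; rewrite /= chartK //; exact: gram_transition. Qed.

Lemma overlap_cod i j xi : (chart i @` (chart_dom i `&` chart_dom j)) xi -> cod i xi.
Proof. by move=> [x [? _] <-]; exists x. Qed.

Lemma transition_cod i j xi : (chart i @` (chart_dom i `&` chart_dom j)) xi ->
  cod j ((chart j \o chart_inv i) xi).
Proof. by move=> [x [? ?] <-]; exists x; rewrite //= chartK. Qed.

(** The constant comes from the single chart at [x]. At a nearby [y] the curvature is computed in
    the unrelated chart [chart_at y], so the vectors spanning the plane are carried back by the
    inverse Jacobian, which changes neither numerator nor denominator. *)
Lemma sectional_curvature_ge x : exists C : R, \forall y \near x,
  forall sigma : 'M[R]_(2, n), - C <= sectional_curvature y sigma.
Proof.
set i := chart_at x; have xi : chart_dom i x by exact: chart_at_dom.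
have [C C0 HC] := sectional_num_near (@chart_cod_open _ _ M i)
  (@gram_Cmx i) (@gram_sym _ _ M i) (@gram_posdef i) (ex_intro2 _ _ x xi erefl).
exists C.
have H1 : \forall y \near x, chart_dom i y.
  by apply: open_nbhs_nbhs; split => //; exact: chart_dom_open.
have H2 := @chart_continuous _ _ M i x (mem_set xi) _ HC.
apply: filterS2 H1 H2 => y yi /= Hy sigma.
rewrite /sectional_curvature /metric /curvature; set j := chart_at y.
have yj : chart_dom j y by exact: chart_at_dom.
set u0 := row 0 sigma; set v0 := row 1 sigma.
pose U := chart i @` (chart_dom i `&` chart_dom j).
have Uy : U (chart i y) by exists y.
have oU : open U := @overlap_open i j.
have UC : U `<=` cod i := @overlap_cod i j.
have gT xi' : U xi' -> (gram i xi')^T = gram i xi' by move=> /UC; exact: gram_sym.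
have gU xi' : U xi' -> gram i xi' \in unitmx.
  by move=> /UC; apply: posdef_unit; exact: gram_posdef.
have hU xi' : cod j xi' -> gram j xi' \in unitmx by apply: posdef_unit; exact: gram_posdef.
have Cgi k : Cmx U k (gram i) by move=> a b; apply: Ck_subset UC _; exact: gram_Cmx.
have Jy := jac_unit gU (@gram_change i j) Uy.
have T u v := Rm_tensor oU (@chart_cod_open _ _ M j) Cgi gT gU (@gram_Cmx j)
  (@gram_sym _ _ M j) hU (@transition_Cmx i j) (@transition_cod i j)
  (@gram_change i j) u v Uy.
set J := jacobian _ _ in Jy T.
pose u := u0 *m invmx J; pose v := v0 *m invmx J.
have uE : u0 = u *m J by rewrite mulmxKV.
have vE : v0 = v *m J by rewrite mulmxKV.
have phiE : (chart j \o chart_inv i) (chart i y) = chart j y by rewrite /= chartK.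
have Q a b : qf (gram j (chart j y)) (a *m J) (b *m J) = qf (gram i (chart i y)) a b.
  by rewrite [in RHS](gram_change Uy) qf_congr phiE.
rewrite -/(Rm (gram j) (chart j y) u0 v0 v0) !qf_def.
rewrite uE vE -phiE -(T u v) phiE !Q.
have [den0 num] := Hy u v.
(* If the rows are dependent, the denominator is 0 and the quotient is 0 by convention, which is
   still at least [- C]. *)
move: den0; rewrite le_eqVlt => /orP[/eqP <-|den0].
  by rewrite invr0 mulr0 oppr_le0.
by rewrite ler_pdivlMr.
Qed.

End Manifold.

(** * Lengths of curves *)

Section OneVariable.
Context {R : realType}.
Implicit Types (f g : R -> R) (x : R).

Lemma is_derive_comp1 f g x (df dg : R) :
  is_derive x 1 f df -> is_derive (f x) 1 g dg ->
  is_derive x 1 (fun y => g (f y)) (dg * df).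
Proof.
move=> [Hf <-] [Hg <-].
have df' : differentiable f x by apply/derivable1_diffP.
have dg' : differentiable g (f x) by apply/derivable1_diffP.
split; first by apply/derivable1_diffP; exact: differentiable_comp.
by have := derive1_comp Hf Hg; rewrite !derive1E.
Qed.

Lemma is_derive_X m x : is_derive x 1 (fun y : R => y ^+ m.+1) (m.+1%:R * x ^+ m).
Proof.
split; first exact: exprn_derivable.
by rewrite exp_derive /= [_ *: 1]mulr1.
Qed.

(** An exponent of at least 2 smooths the corner at 0: there the difference quotient is bounded by
    the absolute value of [h] once this is at most 1. *)
Lemma is_derive_posX m x :
  is_derive x 1 (fun y : R => Num.max 0 y ^+ m.+2) (m.+2%:R * Num.max 0 x ^+ m.+1).
Proof.
have [x0|x0|->] := ltgtP x 0.
- have E : \forall y \near x, cst 0 y = Num.max 0 y ^+ m.+2.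
    by apply: filterS (lt_nbhsl x0) => y /ltW y0; rewrite max_l // expr0n.
  rewrite expr0n mulr0.
  exact: near_eq_is_derive E (is_derive_cst 0 x 1).
- have E : \forall y \near x, y ^+ m.+2 = Num.max 0 y ^+ m.+2.
    by apply: filterS (lt_nbhsr x0) => y /ltW y0; rewrite max_r.
  exact: near_eq_is_derive E (is_derive_X m.+1 x).
rewrite expr0n mulr0.
have H : (fun h : R => h^-1 *: (((fun y : R => Num.max 0 y ^+ m.+2) \o shift 0) (h *: 1)
    - Num.max 0 0 ^+ m.+2)) @ 0^' --> (0 : R).
  apply/cvgrPdist_le => e e0; near=> h.
  have h1 : `|h| <= 1.
    near: h; apply: dnbhs0_le; exact: ltr01.
  have he : `|h| <= e by near: h; exact: dnbhs0_le.
  have h0 : h != 0 by near: h; exact: nbhs_dnbhs_neq.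
  rewrite sub0r normrN /= addr0 [h *: 1]mulr1 maxxx expr0n subr0 /GRing.scale /=.
  rewrite normrM normfV ler_pdivrMl ?normr_gt0 //.
  have mh : `|Num.max 0 h| <= `|h|.
    by have [h0'|h0'] := leP 0 h; rewrite ?normr0.
  rewrite normrX; apply: (@le_trans _ _ (`|h| ^+ m.+2)); first by rewrite lerXn2r ?nnegrE.
  rewrite exprS ler_wpM2l // exprS; apply: le_trans he; rewrite ler_piMr //.
  exact: exprn_ile1.
by split; [apply/cvg_ex; exists 0|exact: (cvg_lim _ H)].
Unshelve. all: by end_near. Qed.

Lemma norm_le_sqrt (lam V Q sp : R) : 0 < lam -> 0 <= V -> lam * V ^+ 2 <= Q ->
  sp = Num.sqrt Q -> V <= sp / Num.sqrt lam.
Proof.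
move=> lam0 V0 VQ ->; rewrite ler_pdivlMr ?sqrtr_gt0 // mulrC.
have -> : Num.sqrt lam * V = Num.sqrt (lam * V ^+ 2).
  by rewrite sqrtrM ?ltW // sqrtr_sqr ger0_norm.
exact: ler_wsqrtr.
Qed.

Lemma pos_slope_le (r Q : R) : 0 <= Q ->
  `|2%:R * Num.max 0 (r ^+ 2 - Q) ^+ 1| <= 2 * r ^+ 2.
Proof.
move=> Q0; rewrite expr1 ger0_norm ?mulr_ge0 ?le_max ?lexx // ler_wpM2l // ge_max.
by rewrite sqr_ge0 gerBl.
Qed.

Lemma sum_prod_le n (a v : 'I_n -> R) (r V : R) :
  (forall k, `|a k| <= r) -> (forall k, `|v k| <= V) ->
  `|\sum_k (v k * a k + a k * v k)| <= n%:R * (2 * (r * V)).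
Proof.
move=> ar vV; apply: le_trans (ler_norm_sum _ _ _) _; rewrite -sum_ord_cst.
apply: ler_sum => k _.
have -> : v k * a k + a k * v k = 2 * (a k * v k) by ring.
rewrite normrM normr_nat ler_wpM2l // normrM.
by apply: ler_pM.
Qed.

(** The origin of the constant [K] in [bump]: the numerator of the bump has slope at most
    [2 * r ^ 2] times [2 * n * r * V], where the coordinate velocity [V] is at most [sp / sl]. The
    summand 1 keeps [K] positive when [n = 0]. *)
Lemma bump_slope_le (m S V sp r sl K Z : R) (n : nat) :
  `|2%:R * m ^+ 1| <= 2 * r ^+ 2 -> `|S| <= n%:R * (2 * (r * V)) -> V <= sp / sl ->
  0 <= r -> 0 < sl -> 0 <= sp -> K = 4 * n%:R * r ^+ 3 / sl + 1 ->
  `|2%:R * m ^+ 1 * (0 - S) * K^-1 + Z * 0| <= sp.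
Proof.
move=> A1 A2 vle r0 sl0 sp0 KE.
have K0 : 0 < K by rewrite KE ltr_wpDl // divr_ge0 ?mulr_ge0 ?exprn_ge0 // ltW.
rewrite mulr0 addr0 normrM [`|K^-1|]gtr0_norm ?invr_gt0 // ler_pdivrMr //.
rewrite sub0r normrM normrN.
apply: le_trans (ler_pM _ _ A1 A2) _ => //.
apply: (@le_trans _ _ (4 * n%:R * r ^+ 3 * (sp / sl))).
  have -> : 2 * r ^+ 2 * (n%:R * (2 * (r * V))) = 4 * n%:R * r ^+ 3 * V by ring.
  by rewrite ler_wpM2l // ?mulr_ge0 ?exprn_ge0.
have -> : 4 * n%:R * r ^+ 3 * (sp / sl) = sp * (4 * n%:R * r ^+ 3 / sl) by ring.
by rewrite ler_wpM2l // KE lerDl.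
Qed.

End OneVariable.

(** * Speed, length and paths on the manifold *)

Section Curves.
Context {R : realType} {n : nat} {M : riemannianManifold R n}.
Implicit Types (x y z p : M) (i j : chart_index M) (c : R -> M) (a b s t : R).

Lemma smooth_curve_continuous c t : smooth_curve_at c t -> c s @[s --> t] --> c t.
Proof.
move=> [i Hi]; have [cti /(_ 0%N) dxi] := nbhs_singleton Hi.
have cxi : (chart i \o c) s @[s --> t] --> chart i (c t).
  by apply: differentiable_continuous; apply/derivable1_diffP.
have cinv : chart_inv i z @[z --> chart i (c t)] --> chart_inv i (chart i (c t)).
  by apply: chart_inv_continuous; rewrite inE; exists (c t).
rewrite chartK // in cinv.
apply: cvg_trans (cvg_comp _ _ cxi cinv).
by apply: near_eq_cvg; apply: filterS Hi => s [csi _] /=; rewrite chartK.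
Qed.

Lemma curve_near_dom c t j : smooth_curve_at c t -> chart_dom j (c t) ->
  \forall s \near t, chart_dom j (c s).
Proof.
move=> /smooth_curve_continuous cc cj; apply: cc.
by apply: open_nbhs_nbhs; split => //; exact: chart_dom_open.
Qed.

Lemma chart_curve i j c t :
  (\forall s \near t, chart_dom i (c s) /\
     forall k, derivable (derive1n k (chart i \o c)) s 1) -> chart_dom j (c t) ->
  derivable (chart j \o c) t 1 /\
  qf (gram j (chart j (c t))) ('D_1 (chart j \o c) t) ('D_1 (chart j \o c) t) =
  qf (gram i (chart i (c t))) ('D_1 (chart i \o c) t) ('D_1 (chart i \o c) t).
Proof.
move=> Hi cj; have [ci /(_ 0%N) dxi] := nbhs_singleton Hi.
have sm : smooth_curve_at c t by exists i.
pose xi := chart i \o c; pose phi := chart j \o chart_inv i.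
pose U := chart i @` (chart_dom i `&` chart_dom j).
have Ux : U (xi t) by exists (c t).
have oU : open U := @overlap_open _ _ _ i j.
have dphi : differentiable phi (xi t).
  exact: (Cmx_differentiable oU (@transition_Cmx _ _ _ i j 1) Ux).
have dx : differentiable xi t by apply/derivable1_diffP.
have dcomp : differentiable (phi \o xi) t by exact: differentiable_comp.
have E : \forall s \near t, (phi \o xi) s = (chart j \o c) s.
  by apply: filterS Hi => s [si _]; rewrite /phi /xi /= chartK.
have dcomp' : derivable (phi \o xi) t 1 by apply/derivable1_diffP.
split; first exact: near_eq_derivable E dcomp'.
rewrite -(near_eq_derive _ E) (deriveE _ dcomp) diff_comp // /= -(deriveE _ dx).
rewrite -(deriveE _ dphi) deriveEjacobian // [in RHS](gram_change Ux) qf_congr.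
by rewrite /= chartK.
Qed.

(** [speed] refers to [chart_at (c t)], which may jump with [t]. Since the norm of the velocity is
    the same in all charts, it can be read in one fixed chart along a piece of the curve. *)
Lemma speed_chart c t j : smooth_curve_at c t -> chart_dom j (c t) ->
  derivable (chart j \o c) t 1 /\
  speed c t = Num.sqrt (qf (gram j (chart j (c t))) ('D_1 (chart j \o c) t) ('D_1 (chart j \o c) t)).
Proof.
move=> [i Hi] cj.
have [dj Ej] := chart_curve Hi cj; split; first exact: dj.
have [_ Ek] := chart_curve Hi (chart_at_dom (c t)).
rewrite Ej -Ek /speed /metric /velocity qf_def.
by rewrite !derive1E.
Qed.

Lemma speed_ge0 c t : 0 <= speed c t.
Proof. exact: sqrtr_ge0. Qed.

Lemma speed_continuous c t : smooth_curve_at c t -> {for t, continuous (speed c)}.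
Proof.
move=> [i Hi]; have [cti dxi] := nbhs_singleton Hi.
pose xi := chart i \o c.
have E : \forall s \near t, speed c s =
    Num.sqrt (\sum_a \sum_b (derive1 xi s 0 a * derive1 xi s 0 b * gram i (xi s) a b)).
  move: (near_join Hi); apply: filterS => s Hs.
  have [si _] := nbhs_singleton Hs.
  have [_ ->] := speed_chart (ex_intro _ i Hs) si.
  by rewrite qfE /xi derive1E.
have cxi : xi s @[s --> t] --> xi t.
  by apply: differentiable_continuous; apply/derivable1_diffP; exact: (dxi 0%N).
have cdxi : derive1 xi s @[s --> t] --> derive1 xi t.
  by apply: differentiable_continuous; apply/derivable1_diffP; exact: (dxi 1%N).
have cent (a : 'I_n) : derive1 xi s 0 a @[s --> t] --> derive1 xi t 0 a.
  exact: (cvg_comp _ _ cdxi (@coord_continuous _ _ _ 0 a _)).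
have ci : cod i (xi t) by exists (c t).
change (speed c s @[s --> t] --> speed c t); rewrite (nbhs_singleton E).
have S : Num.sqrt (\sum_a \sum_b (derive1 xi s 0 a * derive1 xi s 0 b * gram i (xi s) a b))
   @[s --> t] --> Num.sqrt (\sum_a \sum_b (derive1 xi t 0 a * derive1 xi t 0 b * gram i (xi t) a b)).
  apply: continuous_cvg; first exact: sqrt_continuous.
  apply: cvg_sum => a _; apply: cvg_sum => b _; apply: cvgM; first exact: cvgM.
  have cg : gram i z a b @[z --> xi t] --> gram i (xi t) a b.
    exact: (Ck_continuous (gram_Cmx i 0 a b) ci).
  exact: (cvg_comp _ _ cxi cg).
by apply: cvg_trans S; apply: near_eq_cvg; apply: filterS E => s ->.
Qed.

Lemma speed_within c a b : (forall t, t \in `[a, b] -> smooth_curve_at c t) ->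
  {within `[a, b], continuous (speed c)}.
Proof.
move=> H; apply/continuous_in_subspaceT => t tab; apply: speed_continuous.
exact: H.
Qed.

Lemma speed_integrable c a b : (forall t, t \in `[a, b] -> smooth_curve_at c t) ->
  lebesgue_measure.-integrable `[a, b] (EFin \o speed c).
Proof.
move=> H; apply: continuous_compact_integrable; first exact: segment_compact.
exact: speed_within.
Qed.

Lemma curve_length_ge0 c a b : 0 <= curve_length c a b.
Proof. by apply: Rintegral_ge0 => t _; exact: speed_ge0. Qed.

Lemma Rintegral_itv_cst (a b r : R) : a <= b ->
  \int[lebesgue_measure]_(t in `[a, b]) r = r * (b - a).
Proof.
move=> ab; rewrite Rintegral_cst //; congr (_ * _).
rewrite /= lebesgue_measure_itv /= lte_fin; case: ltP => [_|ba] //=.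
by have -> : b = a; [apply/eqP; rewrite eq_le ab ba|rewrite subrr].
Qed.

Lemma curve_length_le c a b K : a <= b -> (forall t, t \in `[a, b] -> smooth_curve_at c t) ->
  (forall t, t \in `[a, b] -> speed c t <= K) -> curve_length c a b <= K * (b - a).
Proof.
move=> ab H HK; rewrite -Rintegral_itv_cst // /curve_length.
apply: le_Rintegral => //; first exact: speed_integrable.
  apply: continuous_compact_integrable; first exact: segment_compact.
  by apply: continuous_subspaceT => ?; exact: cst_continuous.
by move=> t tab; apply: HK; rewrite inE.
Qed.

Lemma curve_length1 c a b : a <= b -> (forall t, t \in `[a, b] -> speed c t = 1) ->
  curve_length c a b = b - a.
Proof.
move=> ab H; rewrite -[RHS]mul1r -Rintegral_itv_cst //.
by apply: eq_Rintegral => t tab; apply: H.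
Qed.

(** The length [F t] from [a] to [t] is a primitive of the speed, so [F + f] and [F - f] have
    nonnegative derivatives and are nondecreasing. *)
Lemma curve_variation c (f : R -> R) a b : a <= b ->
  (forall t, t \in `[a, b] -> smooth_curve_at c t) ->
  (forall t, t \in `[a, b] -> derivable f t 1 /\ `|'D_1 f t| <= speed c t) ->
  `|f b - f a| <= curve_length c a b.
Proof.
rewrite le_eqVlt => /orP[/eqP <- _ _|ab Hc Hf].
  by rewrite subrr normr0 curve_length_ge0.
pose F t := curve_length c a t.
have sub t : t \in `]a, b[%R -> t \in `[a, b] by move=> /subset_itv_oo_cc tab; apply/mem_set.
have dF t : t \in `]a, b[%R -> derivable F t 1 /\ 'D_1 F t = speed c t.
  move=> tab; move: (tab); rewrite in_itv /= => /andP[at_ tb].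
  have [dF EF] := continuous_FTC1_closed tb (speed_integrable Hc) at_ (speed_continuous (Hc _ (sub _ tab))).
  by rewrite -derive1E.
have cF : {within `[a, b], continuous F}.
  by apply: parameterized_integral_continuous; [exact: ltW|exact: speed_integrable].
have df t : t \in `]a, b[%R -> derivable f t 1 by move=> /sub /Hf [].
have cf : {within `[a, b], continuous f}.
  by apply: derivable_within_continuous => t tab; have [|] := Hf t => //; rewrite inE.
have F0 : F a = 0 by rewrite /F /curve_length set_itv1 Rintegral_set1.
have ia : a \in `[a, b]%R by rewrite in_itv /= lexx ltW.
have ib : b \in `[a, b]%R by rewrite in_itv /= lexx ltW.
have key (G : R -> R) : (forall t, t \in `]a, b[%R -> derivable G t 1 /\ 0 <= 'D_1 G t) ->
    {within `[a, b], continuous G} -> G a <= G b.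
  move=> HG cG; apply: (@ger0_derive1_le_cc _ G a b) => //; last exact: ltW.
  - by move=> t /HG [].
  - by move=> t /HG [_]; rewrite derive1E.
rewrite ler_norml; apply/andP; split.
  have : F a + f a <= F b + f b.
    apply: (key (fun t => F t + f t)).
      move=> t tab; have [dFt EF] := dF _ tab; have dft := df _ tab.
      split; first exact: derivableD.
      rewrite (deriveD dFt dft) EF; have [_] := Hf _ (sub _ tab).
      by rewrite ler_norml => /andP[]; lra.
    by move=> t; apply: cvgD; [exact: cF|exact: cf].
  by rewrite F0 /F; lra.
have : F a - f a <= F b - f b.
  apply: (key (fun t => F t - f t)).
    move=> t tab; have [dFt EF] := dF _ tab; have dft := df _ tab.
    split; first exact: derivableB.
    rewrite (deriveB dFt dft) EF; have [_] := Hf _ (sub _ tab).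
    by rewrite ler_norml => /andP[]; lra.
  by move=> t; apply: cvgB; [exact: cF|exact: cf].
by rewrite F0 /F; lra.
Qed.

Lemma joined_ge0 x y (l : R) : joined x y l -> 0 <= l.
Proof. by elim => // *; rewrite addr_ge0 // curve_length_ge0. Qed.

Lemma joined_cat x y z (l l' : R) : joined x y l -> joined y z l' -> joined x z (l + l').
Proof.
move=> H; elim: H z l' => {x y l} [x|c a b y l ab Hc _ IH] z l' Hz.
  by rewrite add0r.
by rewrite -addrA; apply: joined_step => //; exact: IH.
Qed.

Lemma joined_curve c a b : a <= b -> (forall t, t \in `[a, b] -> smooth_curve_at c t) ->
  joined (c a) (c b) (curve_length c a b).
Proof.
move=> ab Hc; rewrite -[X in joined _ _ X]addr0.
by apply: joined_step => //; exact: joined_refl.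
Qed.

Lemma dist_le_joined x y (l : R) : joined x y l -> riemannian_dist x y <= l.
Proof.
move=> H; apply: ge_inf => //; exists 0 => l' /joined_ge0; exact.
Qed.

(** This is how lengths are bounded from below: a test function spares any knowledge of where a path
    runs. *)
Lemma joined_variation (rho : M -> R) :
  (forall c t, smooth_curve_at c t ->
     derivable (rho \o c) t 1 /\ `|'D_1 (rho \o c) t| <= speed c t) ->
  forall x y l, joined x y l -> `|rho y - rho x| <= l.
Proof.
move=> H x y l; elim => {x y l} [x|c a b y l ab Hc _ IH].
  by rewrite subrr normr0.
rewrite -(subrKA (rho (c b))) [leRHS]addrC (le_trans (ler_normD _ _)) // lerD //.
by apply: (curve_variation (f := rho \o c)) => // t /Hc /H.
Qed.

Lemma derive1n_near (V : normedModType R) (f h : R -> V) t :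
  (\forall s \near t, f s = h s) ->
  forall k, \forall s \near t, derive1n k f s = derive1n k h s.
Proof.
move=> fh; elim=> [//|k IH].
move: (near_join IH); apply: filterS => s Hs.
by rewrite !derive1nS !derive1E; exact: near_eq_derive.
Qed.

Lemma derivable_affine m (v w : 'rV[R]_m) k s :
  derivable (derive1n k (fun r : R => v + r *: w)) s 1.
Proof.
have D (r : R) : is_derive r 1 (fun r : R => v + r *: w) w.
  apply: is_derive_eq (is_derive_line (f := id) _) _; first exact: derivable_id.
  exact: derive_id.
have D1 : derive1 (fun r : R => v + r *: w) = cst w.
  by apply/funext => r; rewrite derive1E; have [_] := D r.
have Dc l : exists w', derive1n l (cst w : R -> 'rV[R]_m) = cst w'.
  elim: l => [|l [w' IH]]; first by exists w.
  by exists 0; rewrite derive1nS IH; apply/funext => r; rewrite derive1_cst.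
case: k => [|k]; first by have [] := D s.
by rewrite derive1Sn D1; have [w' ->] := Dc k; exact: derivable_cst.
Qed.

Lemma segment_joined i y z K : 0 <= K -> chart_dom i y -> chart_dom i z ->
  let w := chart i z - chart i y in
  (forall s, 0 <= s <= 1 -> cod i (chart i y + s *: w) /\
     qf (gram i (chart i y + s *: w)) w w <= K ^+ 2) ->
  exists2 l, l <= K & joined y z l.
Proof.
move=> K0 yi zi w H.
pose aff (s : R) := chart i y + s *: w.
pose c := chart_inv i \o aff.
have cE s : cod i (aff s) -> chart_dom i (c s) /\ chart i (c s) = aff s.
  by move=> [u ui E]; rewrite /c /= -E chartK.
have caff s : aff r @[r --> s] --> aff s.
  apply: differentiable_continuous; apply/derivable1_diffP.
  exact: (@derivable_affine _ (chart i y) w 0%N s).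
have Hnear s : 0 <= s <= 1 -> \forall r \near s, chart_dom i (c r) /\ chart i (c r) = aff r.
  move=> /H [ci _]; have Hs : \forall r \near s, cod i (aff r).
    exact: (caff s (cod i) (near_in (@chart_cod_open _ _ M i) ci)).
  by apply: filterS Hs => r /cE.
have Hsm s : 0 <= s <= 1 -> smooth_curve_at c s.
  move=> /Hnear Hs; exists i; move: (near_join Hs); apply: filterS => r Hr.
  split; first by have [] := nbhs_singleton Hr.
  move=> k; apply: near_eq_derivable (@derivable_affine _ (chart i y) w k r).
  apply: derive1n_near; apply: filterS Hr => r' [_ E]; exact/esym.
have Hsm' s : s \in `[0, 1]%classic -> smooth_curve_at c s.
  by rewrite inE /= in_itv /=; exact: Hsm.
have c0 : c 0 = y by rewrite /c /= /aff scale0r addr0 chartK.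
have c1 : c 1 = z by rewrite /c /= /aff scale1r /w addrC subrK chartK.
exists (curve_length c 0 1); last first.
  by rewrite -{1}c0 -c1; exact: joined_curve.
have -> : K = K * (1 - 0) by rewrite subr0 mulr1.
apply: curve_length_le => // s; rewrite inE /= in_itv /= => s01.
have [ci Hq] := H _ s01; have [di Ei] := cE _ ci.
have [_ ->] := speed_chart (Hsm _ s01) di.
have E : \forall r \near s, (chart i \o c) r = aff r by apply: filterS (Hnear _ s01) => r [].
rewrite (near_eq_derive _ E) Ei.
have -> : 'D_1 aff s = w.
  have D : is_derive s 1 aff w.
    apply: is_derive_eq (is_derive_line (f := id) _) _; first exact: derivable_id.
    exact: derive_id.
  by have [_] := D.
by rewrite -(ger0_norm K0) -sqrtr_sqr ler_wsqrtr.
Qed.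

(** The short paths are coordinate segments: a small ball in the chart is convex, and the Gram
    matrices are bounded on it. *)
Lemma joined_near x (e : R) : 0 < e -> exists2 U, nbhs x U &
  forall y z, U y -> U z -> exists2 l, l < e & joined y z l.
Proof.
move=> e0; set i := chart_at x; have xi : chart_dom i x := chart_at_dom x.
have ci : cod i (chart i x) by exists x.
have [C C0 Hg] := near_bounded (f := fun (k : 'I_n * 'I_n) xi => gram i xi k.1 k.2)
  (fun k => Ck_continuous (gram_Cmx i 0 k.1 k.2) ci).
have Hc : \forall xi \near chart i x, cod i xi := near_in (@chart_cod_open _ _ M i) ci.
have [r /= r0 Hr] := (nbhs_ballP _ _).1 (filterI Hg Hc).
pose K := n%:R ^+ 2 * C + 1.
have K1 : 1 <= K by rewrite /K lerDr mulr_ge0 ?exprn_ge0.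
have K0 : 0 < K by exact: lt_le_trans K1.
(* On a segment the squared speed is at most [K * (2 * rho) ^ 2], which [4 * K * rho <= e] and
   [K >= 1] bound by [(e / 2) ^ 2]; the half makes the final inequality strict. *)
pose rho := Num.min r (e / (4 * K)).
have rho0 : 0 < rho by rewrite lt_min r0 divr_gt0 // mulr_gt0.
pose B := ball (chart i x) rho.
exists [set y | chart_dom i y /\ B (chart i y)].
  have H1 : \forall y \near x, chart_dom i y.
    by apply: open_nbhs_nbhs; split => //; exact: chart_dom_open.
  have H2 : \forall y \near x, B (chart i y).
    exact: (@chart_continuous _ _ M i x (mem_set xi) _ (nbhsx_ballx _ _ rho0)).
  by apply: filterS2 H1 H2.
move=> y z [yi By] [zi Bz].
pose w := chart i z - chart i y.
suff Hs s : 0 <= s <= 1 -> cod i (chart i y + s *: w) /\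
     qf (gram i (chart i y + s *: w)) w w <= (e / 2) ^+ 2.
  have e20 : 0 <= e / 2 by rewrite ltW // divr_gt0.
  have [l le jl] := segment_joined e20 yi zi Hs.
  by exists l => //; apply: le_lt_trans le _; rewrite ltr_pdivrMr // ltr_pMr // ltr1n.
move: By Bz; rewrite /B -ball_normE /= => By Bz /andP[s0 s1].
have wle : `|w| <= 2 * rho.
  rewrite /w -(subrKA (chart i x)) (le_trans (ler_normD _ _)) //.
  rewrite distrC; move: By Bz; lra.
have inB : ball (chart i x) r (chart i y + s *: w).
  rewrite -ball_normE /=; apply: (@lt_le_trans _ _ rho); last by rewrite ge_min lexx.
  have -> : chart i x - (chart i y + s *: w) =
      (1 - s) *: (chart i x - chart i y) + s *: (chart i x - chart i z).
    by apply/rowP => k; rewrite /w !mxE; ring.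
  apply: le_lt_trans (ler_normD _ _) _; rewrite !normrZ (ger0_norm s0).
  rewrite ger0_norm ?subr_ge0 //.
  pose m := Num.max `|chart i x - chart i y| `|chart i x - chart i z|.
  have mr : m < rho by rewrite gt_max By Bz.
  apply: le_lt_trans mr; have -> : m = (1 - s) * m + s * m by ring.
  by apply: lerD; apply: ler_wpM2l; rewrite ?subr_ge0 // le_max lexx ?orbT.
have [Hgs Hcs] := Hr _ inB; split=> //.
have Hab (a b : 'I_n) : `|gram i (chart i y + s *: w) a b| <= C := Hgs (a, b).
apply: le_trans (ler_norm _) _; apply: le_trans (qf_le _ _ C0 Hab) _.
apply: (@le_trans _ _ (K * (2 * rho) ^+ 2)).
  rewrite -mulrA -expr2; apply: ler_pM => //; rewrite ?mulr_ge0 ?exprn_ge0 //.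
    by rewrite /K lerDl.
  by rewrite lerXn2r ?nnegrE // (le_trans _ wle).
have rhoK : rho * (4 * K) <= e by rewrite -ler_pdivlMr ?mulr_gt0 // ge_min lexx orbT.
have : (rho * (4 * K)) ^+ 2 <= e ^+ 2.
  by rewrite lerXn2r ?nnegrE ?mulr_ge0 // ltW // ?mulr_gt0.
move=> H; have -> : (e / 2) ^+ 2 = e ^+ 2 / 4 by field.
apply: le_trans (_ : (rho * (4 * K)) ^+ 2 / 4 <= _); last by rewrite ler_wpM2r.
have -> : (rho * (4 * K)) ^+ 2 / 4 = K * (K * (2 * rho) ^+ 2) by field.
by rewrite ler_peMl // mulr_ge0 ?exprn_ge0 // ltW // mulr_gt0.
Qed.

(** By [joined_near] the points reachable from [x] form an open and closed set. Hence the infimum in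
    [riemannian_dist] is never over the empty set, and a small distance yields an actual short
    path. *)
Lemma all_joined x y : exists l : R, joined x y l.
Proof.
pose A := [set y | exists l : R, joined x y l].
have loc z : exists2 U, nbhs z U & forall y y', U y -> U y' -> A y -> A y'.
  have [U Uz HU] := joined_near z ltr01; exists U => // u u' Uu Uu' [l jl].
  have [l' _ jl'] := HU _ _ Uu Uu'.
  by exists (l + l'); exact: joined_cat jl jl'.
have oA : open A.
  rewrite openE => z Az; have [U Uz HU] := loc z.
  by apply: filterS (Uz) => z' Uz'; apply: HU Az => //; exact: (nbhs_singleton Uz).
have cA : closed A.
  rewrite -openC openE => z nAz; have [U Uz HU] := loc z.
  apply: filterS (Uz) => z' Uz' Az'; apply: nAz.
  by apply: HU Az' => //; exact: (nbhs_singleton Uz).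
suff : A y by [].
suff -> : A = [set: M] by [].
apply: (@carrier_connected _ _ M); first by exists x, 0; exact: joined_refl.
  by exists A => //; rewrite setTI.
by exists A => //; rewrite setTI.
Qed.

(** The converse link between lengths and topology: a path from [x] shorter than [rho x] ends in the
    compact set [N], even if it leaves the chart on its way. *)
Lemma bump x : exists (rho : M -> R) (N : set M),
  [/\ compact N, 0 < rho x, (forall z, 0 < rho z -> N z) &
      forall y z l, joined y z l -> `|rho z - rho y| <= l].
Proof.
set i := chart_at x; have xi : chart_dom i x := chart_at_dom x.
set xi0 := chart i x; have ci : cod i xi0 by exists x.
have [lam lam0 Hlam] := posdef_near (@gram_Cmx _ _ M i)
  (@gram_posdef _ _ M i) ci.
have Hc : \forall xi \near xi0, cod i xi := near_in (@chart_cod_open _ _ M i) ci.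
have [r' /= r'0 Hr'] := (nbhs_ballP _ _).1 (filterI Hlam Hc).
(* Half the radius, so that the closed ball [D] lies in the open ball on which the estimates
   hold. *)
pose r := r' / 2; have r0 : 0 < r by rewrite divr_gt0.
pose D := [set v : 'rV[R]_n | `|xi0 - v| <= r].
have DB v : D v -> ball xi0 r' v.
  rewrite /D /= -ball_normE /= => /le_lt_trans; apply.
  by rewrite ltr_pdivrMr // ltr_pMr // ltr1n.
have Dcod v : D v -> cod i v by move=> /DB /Hr' [].
have Dpos v : D v -> forall w, lam * `|w| ^+ 2 <= qf (gram i v) w w by move=> /DB /Hr' [].
have cD : compact D.
  apply: bounded_closed_compact.
    exists (`|xi0| + r); split; first exact: num_real.
    move=> m mr v /= vr; apply/ltW/(le_lt_trans _ mr).
    by rewrite -[v](subKr xi0) (le_trans (ler_normB _ _)) // lerD2l.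
  exact: closed_closed_ball_.
pose N := chart_inv i @` D.
have cN : compact N.
  apply: continuous_compact cD; apply/continuous_in_subspaceT => v; rewrite inE => /Dcod vc.
  by apply: chart_inv_continuous; rewrite inE.
have Ndom z : N z -> chart_dom i z.
  by move=> [v /Dcod [u ui <-] <-]; rewrite chartK.
have ND z : N z -> D (chart i z).
  by move=> [v Dv <-]; have [u ui E] := Dcod _ Dv; rewrite -E chartK // E.
have DN z : chart_dom i z -> D (chart i z) -> N z.
  by move=> zi Dz; exists (chart i z) => //; rewrite chartK.
(* The squared Euclidean distance, differentiable unlike the sup norm; where it is below [r ^ 2] the
   point lies in [D]. *)
pose q (v : 'rV[R]_n) := \sum_k (v 0 k - xi0 0 k) ^+ 2.
pose K := 4 * n%:R * r ^+ 3 / Num.sqrt lam + 1.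
have sl0 : 0 < Num.sqrt lam by rewrite sqrtr_gt0.
have K0 : 0 < K by rewrite ltr_wpDl // divr_ge0 ?mulr_ge0 ?exprn_ge0 // ltW.
(* Squaring the positive part makes the extension by 0 differentiable along curves, and dividing by
   [K] brings its slope below the speed. *)
pose b (v : 'rV[R]_n) := Num.max 0 (r ^+ 2 - q v) ^+ 2 / K.
pose rho z := if pselect (N z) then b (chart i z) else 0.
have rhoE z : chart_dom i z -> rho z = b (chart i z).
  rewrite /rho => zi; case: pselect => // nN; rewrite /b max_l ?expr0n ?mul0r //.
  rewrite subr_le0 leNgt; apply/negP => qr; apply: nN; apply: DN => //.
  apply: norm_row_le; first exact: ltW.
  move=> k; rewrite !mxE distrC -ler_sqr ?nnegrE //; last exact: ltW.
  rewrite -normrX ger0_norm ?sqr_ge0 // (le_trans _ (ltW qr)) // /q (bigD1 k) //= lerDl.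
  by apply: sumr_ge0 => j _; exact: sqr_ge0.
exists rho, N; split => //.
- rewrite rhoE // /b divr_gt0 // exprn_gt0 // lt_max; apply/orP; right.
  rewrite /q big1 ?subr0 ?exprn_gt0 // => k _; by rewrite subrr expr0n.
- by move=> z; rewrite /rho; case: pselect => // nN; rewrite /= ltxx.
apply: joined_variation => c t ct.
have [Nt|nNt] := pselect (N (c t)); last first.
  (* [N] is closed, being compact in a Hausdorff space, so the curve stays outside it near [t]. *)
  have E : \forall s \near t, cst 0 s = (rho \o c) s.
    have cl : closed N := compact_closed (@carrier_hausdorff _ _ M) cN.
    have : \forall s \near t, (~` N) (c s).
      by apply: (smooth_curve_continuous ct); apply: open_nbhs_nbhs; split => //; exact: closed_openC.
    by apply: filterS => s nN /=; rewrite /rho; case: pselect.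
  have [D1 ->] := near_eq_is_derive E (is_derive_cst (0 : R) t (1 : R)).
  by split => //; rewrite normr0 speed_ge0.
have [dxi Es] := speed_chart ct (Ndom _ Nt).
set xit := chart i \o c in dxi Es; set v := 'D_1 xit t in Es.
have Dv : is_derive t 1 xit v by exact: derivableP.
have Dk := (is_derive_mxP _ _ _ _).1 Dv 0.
have Dq : is_derive t 1 (fun s => r ^+ 2 - q (xit s))
    (0 - \sum_k (v 0 k * (xit t 0 k - xi0 0 k) + (xit t 0 k - xi0 0 k) * v 0 k)).
  apply: is_deriveB; apply: is_derive_sum_fun => k.
  have H : is_derive t 1 (fun s => xit s 0 k - xi0 0 k) (v 0 k).
    by apply: is_derive_eq (is_deriveB (Dk k) (is_derive_cst (xi0 0 k) t 1)) _; rewrite subr0.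
  exact: (is_derive_mul H H).
have Db := is_derive_mul (is_derive_comp1 Dq (is_derive_posX 0 _)) (is_derive_cst K^-1 t 1).
have E : \forall s \near t, Num.max 0 (r ^+ 2 - q (xit s)) ^+ 2 * cst K^-1 s = (rho \o c) s.
  apply: filterS (curve_near_dom ct (Ndom _ Nt)) => s si.
  by rewrite /= rhoE.
have [D1 ->] := near_eq_is_derive E Db; split; first exact: D1.
have vle := norm_le_sqrt lam0 (normr_ge0 v) (Dpos _ (ND _ Nt) v) Es.
have Dt := ND _ Nt.
have kle k : `|xit t 0 k - xi0 0 k| <= r.
  apply: le_trans Dt; rewrite distrC.
  by have := norm_coord_le (xi0 - chart i (c t)) k; rewrite !mxE.
have q0 : 0 <= q (xit t) by apply: sumr_ge0 => k _; exact: sqr_ge0.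
have A1 := pos_slope_le r q0.
have A2 := sum_prod_le kle (norm_coord_le v).
exact: (bump_slope_le _ A1 A2 vle (ltW r0) sl0 (speed_ge0 c t) (erefl K)).
Qed.

End Curves.

(** * Relative compactness of geodesic balls *)

(** If [P K] failed, the sets [A] with [P] of [K] minus [A] would form a proper filter containing
    [K]. At a cluster point of it, a neighbourhood with [P] would have its complement in the filter,
    which is absurd. *)
Lemma compact_local_global (T : topologicalType) (P : set T -> Prop) (K : set T) :
  P set0 -> (forall A B, A `<=` B -> P B -> P A) ->
  (forall A B, P A -> P B -> P (A `|` B)) ->
  compact K -> (forall x, K x -> exists2 U, nbhs x U & P U) -> P K.
Proof.
move=> P0 PS PU cK locP; apply: contrapT => nPK.
pose F : set_system T := [set A | P (K `\` A)].
have FF : ProperFilter F.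
  apply: Build_ProperFilter; first by rewrite /F /= setD0.
  split; first by rewrite /F /= setDT.
    by move=> A B FA FB; rewrite /F /= setDIr; exact: PU.
  by move=> A B AB; apply: PS => x [Kx nB]; split=> // /AB.
have FK : F K by rewrite /F /= setDv.
have [x [Kx clx]] := cK F FF FK; have [U Ux PUx] := locP _ Kx.
have FU : F (~` U) by apply: PS PUx => y [_ /contrapT].
by have [y [nU Uy]] := clx _ _ FU Ux.
Qed.

Lemma qfNN (R : realType) n (A : 'M[R]_n) u : qf A (- u) (- u) = qf A u u.
Proof. by rewrite -scaleN1r qfZl qfZr mulrA mulN1r opprK mul1r. Qed.

(** * Reversal of curves *)

Section Reversal.
Context {R : realType} {n : nat} {M : riemannianManifold R n}.
Implicit Types (c : R -> M) (a b s t : R).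

Lemma is_derive_opp (V : normedModType R) (f : R -> V) s : derivable f (- s) 1 ->
  is_derive s 1 (fun r => f (- r)) (- 'D_1 f (- s)).
Proof.
move=> df; have dif : differentiable f (- s) by apply/derivable1_diffP.
have E r : 0 + r *: (-1 : R) = - r by rewrite add0r /GRing.scale /= mulrN1.
have df' : derivable f (0 + s *: (-1 : R)) (-1) by rewrite E; exact: diff_derivable.
have := is_derive_line df'; under eq_fun do rewrite E; rewrite E.
have -> // : 'D_(-1) f (- s) = - 'D_1 f (- s).
by rewrite (deriveE (-1 : R) dif) (deriveE (1 : R) dif) linearN.
Qed.

Lemma near_opp (P : set R) t : (\forall s \near t, P s) -> \forall s \near - t, P (- s).
Proof.
move=> Pt; have H : (- s : R) @[s --> - t] --> - - t by apply: cvgN; exact: cvg_id.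
by rewrite opprK in H; exact: (H P Pt).
Qed.

Lemma derive1n_opp (V : normedModType R) (f : R -> V) t :
  (\forall s \near t, forall k, derivable (derive1n k f) s 1) ->
  forall k, \forall s \near - t,
    derive1n k (fun r => f (- r)) s = (-1) ^+ k *: derive1n k f (- s).
Proof.
move=> Hf; elim=> [|k IH]; first by apply: filterE => s; rewrite scale1r.
have H1 := near_opp Hf; move: (near_join IH).
apply: filterS2 H1 => s ds Hs; rewrite !derive1nS !derive1E (near_eq_derive _ Hs).
have [d E] := is_derive_opp (ds k).
by rewrite deriveZ // E exprS mulN1r scalerN scaleNr.
Qed.

Lemma smooth_curve_opp c t : smooth_curve_at c t ->
  smooth_curve_at (fun s => c (- s)) (- t).
Proof.
move=> [i Hi]; exists i.
have Hf : \forall s \near t, forall k, derivable (derive1n k (chart i \o c)) s 1.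
  by apply: filterS Hi => s [].
have Hj := near_join Hf.
apply: filterS2 (near_opp Hi) (near_opp Hj) => s [si ds] Hs; split; [exact: si|move=> k].
have Hk := derive1n_opp Hs k; rewrite opprK in Hk.
have D : derivable (fun r => (-1) ^+ k *: derive1n k (chart i \o c) (- r)) s 1.
  by have [d _] := is_derive_opp (ds k); apply: derivableZ.
by apply: near_eq_derivable D; apply: filterS Hk.
Qed.

Lemma speed_opp c t : smooth_curve_at c t -> speed (fun s => c (- s)) (- t) = speed c t.
Proof.
move=> ct; have ct' := smooth_curve_opp ct.
have ci := chart_at_dom (c t); set i := chart_at (c t) in ci.
have ci' : chart_dom i (c (- - t)) by rewrite opprK.
have [d ->] := speed_chart ct ci; have [_ ->] := speed_chart ct' ci'.
have d' : derivable (chart i \o c) (- - t) 1 by rewrite opprK.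
have [_] := is_derive_opp d'; rewrite opprK => E.
have -> : 'D_1 (chart i \o (fun s => c (- s))) (- t) = - 'D_1 (chart i \o c) t := E.
by rewrite qfNN.
Qed.

(** The constructors of [joined] run curves forwards only; the backward path has to be produced from
    the reversed curve. *)
Lemma joined_unit_speed c a b : a <= b ->
  (forall t, a <= t <= b -> smooth_curve_at c t /\ speed c t = 1) ->
  joined (c a) (c b) (b - a) /\ joined (c b) (c a) (b - a).
Proof.
move=> ab H; split.
  rewrite -(curve_length1 (c := c)) //; last first.
    by move=> t; rewrite inE /= in_itv /= => /H [].
  by apply: joined_curve => // t; rewrite inE /= in_itv /= => /H [].
have H' t : t \in `[- b, - a]%classic -> a <= - t <= b.
  by rewrite inE /= in_itv /= lerNr lerNl andbC.
have ab' : - b <= - a by rewrite lerN2.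
have -> : b - a = - a - - b by rewrite opprK addrC.
rewrite -(curve_length1 (c := fun s => c (- s))) //; last first.
  by move=> t /H' /H [ct <-]; rewrite -{1}[t]opprK; exact: speed_opp.
have := @joined_curve _ _ _ (fun s => c (- s)) (- b) (- a) ab'; rewrite !opprK; apply.
by move=> t /H' /H [ct _]; rewrite -[t]opprK; exact: smooth_curve_opp.
Qed.

End Reversal.

(** * Geodesic balls in a complete manifold *)

Section HopfRinow.
Context {R : realType} {n : nat} {M : riemannianManifold R n}.
Hypothesis hcomplete : complete_manifold M.
Variable p : M.
Implicit Types (x y z : M) (A B : set M).

Definition relcompact B := exists2 N : set M, compact N & B `<=` N.

Lemma relcompactS A B : A `<=` B -> relcompact B -> relcompact A.
Proof. by move=> AB [N cN BN]; exists N => //; exact: subset_trans BN. Qed.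

Lemma relcompactU A B : relcompact A -> relcompact B -> relcompact (A `|` B).
Proof.
move=> [N cN AN] [N' cN' BN]; exists (N `|` N'); first exact: compactU.
by move=> x [/AN|/BN]; [left|right].
Qed.

Lemma relcompact0 : relcompact set0.
Proof. by exists set0 => //; exact: compact0. Qed.

(** Only points on minimal geodesics from [p] are collected, since these are the points at which a
    curvature bound is required; the existence of geodesics is not presupposed. *)
Definition geod_ball (r : R) : set M := [set z | exists (c : R -> M) (a : \bar R) (t : R),
  [/\ unit_minimal_geodesic c a, c 0 = p, 0 <= t, (t%:E < a)%E & t <= r /\ z = c t]].

Lemma geod_joined (c : R -> M) (a : \bar R) s t : unit_minimal_geodesic c a ->
  0 <= s -> s <= t -> (t%:E < a)%E ->
  joined (c s) (c t) (t - s) /\ joined (c t) (c s) (t - s).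
Proof.
move=> [H _] s0 st ta; apply: joined_unit_speed => // u /andP[su ut].
have [||[sm _] sp] := H u; [exact: le_trans su| |by []].
by apply: le_lt_trans ta; rewrite lee_fin.
Qed.

(** Back up along the geodesic to time [min t r]. Both directions are recorded because paths are
    later concatenated through [y]. *)
Lemma geod_ball_retract (r r' : R) z : 0 <= r -> r <= r' -> geod_ball r' z ->
  exists y l, [/\ geod_ball r y, l <= r' - r, joined y z l & joined z y l].
Proof.
move=> r0 rr' [c [a [t [cg c0 t0 ta [tr ->]]]]].
pose s := Num.min t r.
have s0 : 0 <= s by rewrite le_min t0.
have st : s <= t by rewrite ge_min lexx.
have sr : s <= r by rewrite ge_min lexx orbT.
have [j1 j2] := geod_joined cg s0 st ta.
exists (c s), (t - s); split => //.
  exists c, a, s; split => //; by apply: le_lt_trans ta; rewrite lee_fin.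
have [tr'|tr'] := leP t r; first by rewrite /s min_l // subrr subr_ge0.
by rewrite /s min_r ?lerD2r // ltW.
Qed.

Lemma geod_ballS (r r' : R) : r <= r' -> geod_ball r `<=` geod_ball r'.
Proof.
move=> rr' z [c [a [t [cg c0 t0 ta [tr ->]]]]]; exists c, a, t; split=> //.
by split=> //; exact: le_trans rr'.
Qed.

Lemma geod_ball_open (r : R) : 0 <= r -> relcompact (geod_ball r) ->
  exists2 d : R, 0 < d & relcompact (geod_ball (r + d)).
Proof.
move=> r0 [K cK SK].
pose Q B := exists2 d : R, 0 < d &
  relcompact [set z | exists y l, [/\ B y, l < d & joined y z l]].
have [d d0 Hd] : Q K.
  apply: compact_local_global => //.
  - by exists 1 => //; apply: relcompactS relcompact0 => z [y [l []]].
  - move=> A B AB [d d0 H]; exists d => //; apply: relcompactS H => z [y [l [/AB By ld j]]].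
    by exists y, l.
  - move=> A B [d d0 H] [d' d'0 H']; exists (Num.min d d'); first by rewrite lt_min d0.
    apply: relcompactS (relcompactU H H') => z [y [l [[Ay|By] ]]];
      rewrite lt_min => /andP[ld ld'] j; [left|right]; by exists y, l.
  (* From [x] to [y] and again from [y] to [z] the bump loses less than half of [rho x], so it is
     still positive at [z]. *)
  move=> x _; have [rho [N [cN rx rN rl]]] := bump x.
  have [U Ux HU] := joined_near x (divr_gt0 rx (ltr0n R 2)).
  exists U => //; exists (rho x / 2); first by rewrite divr_gt0.
  exists N => // z [y [l [Uy ld j]]]; apply: rN.
  have [l' l'd j'] := HU _ _ (nbhs_singleton Ux) Uy.
  have := rl _ _ _ j; have := rl _ _ _ j'.
  by rewrite !ler_norml => /andP[? ?] /andP[? ?]; lra.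
(* Retraction only gives a path of length at most the increment, whereas [Hd] asks for length
   strictly below [d]. *)
exists (d / 2); first by rewrite divr_gt0.
apply: relcompactS Hd => z zr.
have [|y [l [yr ld j _]]] := geod_ball_retract r0 _ zr.
  by rewrite lerDl divr_ge0 // ltW.
by exists y, l; split => //; [exact: SK|move: ld; lra].
Qed.

(** Otherwise every subset of [B] of path diameter below [e] would be relatively compact. But [B]
    lies within [e / 4] of a compact set containing a smaller geodesic ball; finitely many small
    pieces of that set cut [B] into pieces of diameter below [3 * e / 4], and [B] would be
    relatively compact. *)
Lemma geod_ball_split (r e : R) B : 0 < r -> 0 < e ->
  (forall r', r' < r -> relcompact (geod_ball r')) -> B `<=` geod_ball r ->
  ~ relcompact B -> exists B' : set M, [/\ B' `<=` B, ~ relcompact B' &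
    forall y z, B' y -> B' z -> exists2 l, l < e & joined y z l].
Proof.
move=> r0 e0 Hr Br nB; apply: contrapT => nex; apply: nB.
have small B' : B' `<=` B ->
    (forall y z, B' y -> B' z -> exists2 l, l < e & joined y z l) -> relcompact B'.
  by move=> B'B H; apply: contrapT => nB'; apply: nex; exists B'.
(* The maximum with 0 is there because [geod_ball_retract] asks for a nonnegative radius. *)
pose s := Num.max 0 (r - e / 4).
have s0 : 0 <= s by rewrite le_max lexx.
have sr : s < r by rewrite gt_max r0 /=; lra.
have [K cK SK] := Hr _ sr.
pose Q A := relcompact [set z | B z /\ exists y l,
  [/\ A y, l <= e / 4, joined y z l & joined z y l]].
suff QK : Q K.
  apply: relcompactS QK => z Bz; split => //.
  have [y [l [ys ls j1 j2]]] := geod_ball_retract s0 (ltW sr) (Br _ Bz).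
  exists y, l; split => //; first exact: SK.
  apply: le_trans ls _; have : r - e / 4 <= s by rewrite le_max lexx orbT.
  by lra.
apply: compact_local_global => //.
- by apply: relcompactS relcompact0 => z [_ [y [l []]]].
- move=> A A' AA'; apply: relcompactS => z [Bz [y [l [/AA' Ay ? ? ?]]]].
  by split=> //; exists y, l.
- move=> A A' H H'; apply: relcompactS (relcompactU H H') => z [Bz [y [l [[Ay|Ay] ? ? ?]]]];
    [left|right]; by split => //; exists y, l.
move=> x _; have e40 : 0 < e / 4 by rewrite divr_gt0.
have [U Ux HU] := joined_near x e40.
exists U => //; apply: small; first by move=> z [].
move=> z z' [_ [y [l [Uy le_ j1 j2]]]] [_ [y' [l' [Uy' le' j1' j2']]]].
have [l'' le'' j] := HU _ _ Uy Uy'.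
exists (l + l'' + l'); first by lra.
by apply: joined_cat j1'; exact: joined_cat j2 j.
Qed.

(* Otherwise [geod_ball_split] yields a decreasing sequence of sets of size tending to 0
   none of which is relatively compact; points chosen in them form a Cauchy sequence,
   and a compact neighbourhood of its limit contains one of the sets. *)
Lemma geod_ball_closed (r : R) : 0 < r ->
  (forall r', r' < r -> relcompact (geod_ball r')) -> relcompact (geod_ball r).
Proof.
move=> r0 Hr; apply: contrapT => nS.
(* Carrying both invariants in the type lets the sequence be built by recursion from a choice
   function. *)
pose T := {B : set M | B `<=` geod_ball r /\ ~ relcompact B}.
have step (k : nat) (B : T) : {B' : T | sval B' `<=` sval B &
    forall y z, sval B' y -> sval B' z -> exists2 l, l < k.+1%:R^-1 & joined y z l}.
  apply: cid2; case: B => B [Br nB] /=.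
  have e0 : 0 < k.+1%:R^-1 :> R by rewrite invr_gt0.
  have [B' [B'B nB' H]] := geod_ball_split r0 e0 Hr Br nB.
  have pB' : B' `<=` geod_ball r /\ ~ relcompact B' by split=> //; exact: subset_trans Br.
  by exists (exist _ B' pB').
pose T0 : T := exist _ (geod_ball r) (conj (@subset_refl _ _) nS).
pose Bs := fix Bs k : T := if k is k'.+1 then s2val (step k' (Bs k')) else T0.
have BS k : sval (Bs k.+1) `<=` sval (Bs k) by exact: (s2valP (step k (Bs k))).
have Bsm k y z : sval (Bs k.+1) y -> sval (Bs k.+1) z ->
    exists2 l, l < k.+1%:R^-1 & joined y z l by exact: (s2valP' (step k (Bs k))).
have Bmono k l : (k <= l)%N -> sval (Bs l) `<=` sval (Bs k).
  move=> kl; rewrite -(subnK kl); elim: (l - k)%N => // m IH.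
  by rewrite addSn; apply: subset_trans IH; exact: BS.
have Bne k : exists z, sval (Bs k) z.
  apply: contrapT => nz; have [_] := svalP (Bs k); apply.
  apply: relcompactS relcompact0 => z Bz; apply: nz; by exists z.
(* The diameter bound [1 / (k + 1)] holds for [Bs k.+1], hence the shift. *)
pose u k := sval (cid (Bne k.+1)).
have uB k : sval (Bs k.+1) (u k) by exact: (svalP (cid (Bne k.+1))).
have arch (e : R) : 0 < e -> exists N : nat, N.+1%:R^-1 < e.
  move=> e0; have [N _ HN] := near_infty_natSinv_lt (PosNum e0).
  by exists N; apply: HN => /=.
have [|x ux] := hcomplete (u := u).
  move=> e /arch [N Ne]; exists N => k l Nk Nl.
  have [d dN j] := Bsm N _ _ (Bmono N.+1 k.+1 Nk _ (uB k)) (Bmono N.+1 l.+1 Nl _ (uB l)).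
  exact: le_lt_trans (dist_le_joined j) (lt_trans dN Ne).
have [rho [N [cN rx rN rl]]] := bump x.
have r40 : 0 < rho x / 4 by rewrite divr_gt0.
have [N1 HN1] := arch _ r40.
have [N2 _ HN2] : \forall k \near \oo, riemannian_dist (u k) x < rho x / 4.
  move/cvgrPdist_lt : ux => /(_ _ r40); apply: filterS => k.
  by rewrite sub0r normrN => /(le_lt_trans (ler_norm _)).
pose k := maxn N1 N2.
(* The distance is an infimum over a nonempty set of lengths, so being below [rho x / 4] yields a
   path that short. *)
have [l lk jl] : exists2 l, l < rho x / 4 & joined (u k) x l.
  have inf_uk : has_inf [set l | joined (u k) x l].
    split; first exact: all_joined.
    by exists 0 => l; exact: joined_ge0.
  have d0 : 0 < rho x / 4 - riemannian_dist (u k) x.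
    by rewrite subr_gt0; apply: HN2; exact: leq_maxr.
  have [l jl] := inf_adherent d0 inf_uk.
  by rewrite -/(riemannian_dist (u k) x) addrC subrK => ll; exists l.
(* From [x] to [u k] and on to [z] the bump loses less than [rho x / 2]; thus [Bs k.+1] lies in the
   compact set [N], a contradiction. *)
have [_] := svalP (Bs k.+1); apply; exists N => // z Bz; apply: rN.
have [l' l'k jl'] := Bsm k _ _ (uB k) Bz.
have kN1 : k.+1%:R^-1 <= N1.+1%:R^-1 :> R.
  by rewrite lef_pV2 ?posrE // ler_nat ltnS leq_maxl.
have l'x : l' < rho x / 4 by exact: lt_trans (lt_le_trans l'k kN1) HN1.
have := rl _ _ _ jl; have := rl _ _ _ jl'.
by rewrite !ler_norml => /andP[? ?] /andP[? ?]; move: rx lk l'x; lra.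
Qed.

(** Continuous induction on the radius: were some radius bad, the supremum of the good ones would be
    good by [geod_ball_closed] and could be exceeded by [geod_ball_open]. *)
Lemma geod_ball_relcompact (r : R) : relcompact (geod_ball r).
Proof.
apply: contrapT => nr.
pose A := [set s : R | relcompact (geod_ball s)].
have A0 : A 0.
  exists [set p]; first exact: compact_set1.
  move=> z [c [a [t [_ c0 t0 _ [t0' ->]]]]].
  by have -> : t = 0 by apply/eqP; rewrite eq_le t0 t0'.
have Aub : ubound A r.
  move=> s As; rewrite leNgt; apply/negP => rs; apply: nr.
  by apply: relcompactS As; apply: geod_ballS; exact: ltW.
have supA : has_sup A by split; [exists 0|exists r].
have sup0 : 0 <= sup A by apply: ub_le_sup => //; exists r.
have below s : s < sup A -> relcompact (geod_ball s).
  move=> ss; have ss0 : 0 < sup A - s by rewrite subr_gt0.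
  have [s' As' s's] := sup_adherent ss0 supA.
  rewrite opprB addrC subrK in s's.
  by apply: relcompactS As'; apply: geod_ballS; exact: ltW.
have Asup : A (sup A).
  (* Radius 0 is the starting case [A0]; [geod_ball_closed] deals with positive radii. *)
  move: sup0; rewrite le_eqVlt => /orP[/eqP <- //|sup0].
  exact: geod_ball_closed.
have [d d0 Ad] := geod_ball_open sup0 Asup.
have : sup A + d <= sup A by apply: ub_le_sup => //; exists r.
by rewrite gerDl leNgt d0.
Qed.

Lemma geod_ball_curvature (r : R) : exists C : R, forall y, geod_ball r y ->
  forall sigma : 'M[R]_(2, n), - C <= sectional_curvature y sigma.
Proof.
have [K cK rK] := geod_ball_relcompact r.
pose Q A := exists C : R, forall y, A y ->
  forall sigma : 'M[R]_(2, n), - C <= sectional_curvature y sigma.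
have [C HC] : Q K; last by exists C => y /rK; exact: HC.
apply: compact_local_global => //.
- by exists 0.
- by move=> A B AB [C HC]; exists C => y /AB; exact: HC.
- move=> A B [C HC] [C' HC']; exists (Num.max C C') => y [/HC|/HC'] H sigma;
    by apply: le_trans (H sigma); rewrite lerN2 le_max lexx ?orbT.
move=> x _; have [C HC] := sectional_curvature_ge x.
by exists [set y | forall sigma : 'M[R]_(2, n), - C <= sectional_curvature y sigma] => //; exists C.
Qed.

End HopfRinow.

(** * Model surfaces with prescribed curvature bound *)

Section LipschitzOn.
Context {R : realType}.
Implicit Types (f g : R -> R) (T : R).

(** A uniform constant on a bounded interval: such functions are bounded there, so products stay
    Lipschitz, and all [T] together give the local property. *)
Definition lip_on T f := exists2 C : R, 0 <= C &
  forall x y, 0 <= x <= T -> 0 <= y <= T -> `|f x - f y| <= C * `|x - y|.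

Lemma lip_on_congr T f g : (forall x, 0 <= x <= T -> f x = g x) -> lip_on T f -> lip_on T g.
Proof.
move=> fg [C C0 H]; exists C => // x y xT yT.
by rewrite -!fg //; exact: H.
Qed.

Lemma lip_on_cst T (c : R) : lip_on T (fun=> c).
Proof. by exists 0 => // x y _ _; rewrite subrr normr0 mul0r. Qed.

Lemma lip_on_id T : lip_on T id.
Proof. by exists 1 => // x y _ _; rewrite mul1r. Qed.

Lemma lip_onD T f g : lip_on T f -> lip_on T g -> lip_on T (fun x => f x + g x).
Proof.
move=> [C C0 H] [D D0 H']; exists (C + D) => [|x y xT yT]; first exact: addr_ge0.
rewrite opprD addrACA mulrDl (le_trans (ler_normD _ _)) // lerD //.
  exact: H.
exact: H'.
Qed.

Lemma lip_on_bounded T f : lip_on T f -> exists2 B : R, 0 <= B &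
  forall x, 0 <= x <= T -> `|f x| <= B.
Proof.
move=> [C C0 H]; exists (`|f 0| + C * `|T|) => [|x /andP[x0 xT]].
  by rewrite addr_ge0 // mulr_ge0.
have T0 : 0 <= T by exact: le_trans xT.
have hx : `|f x - f 0| <= C * `|x - 0| by apply: H; rewrite ?x0 ?xT ?lexx.
rewrite -[f x](subrK (f 0)) addrC (le_trans (ler_normD _ _)) // lerD2l.
by apply: le_trans hx _; rewrite ler_wpM2l // subr0 !ger0_norm.
Qed.

Lemma lip_onM T f g : lip_on T f -> lip_on T g -> lip_on T (fun x => f x * g x).
Proof.
move=> Lf Lg; have [Bf Bf0 Hf] := lip_on_bounded Lf; have [Bg Bg0 Hg] := lip_on_bounded Lg.
case: Lf Lg => [C C0 H] [D D0 H']; exists (Bf * D + C * Bg) => [|x y xT yT].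
  by rewrite addr_ge0 // mulr_ge0.
have -> : f x * g x - f y * g y = f x * (g x - g y) + (f x - f y) * g y by ring.
rewrite (le_trans (ler_normD _ _)) // !normrM mulrDl; apply: lerD.
  by rewrite -mulrA; apply: ler_pM => //; [exact: Hf|exact: H'].
by rewrite mulrAC; apply: ler_pM => //; [exact: H|exact: Hg].
Qed.

Lemma lip_onX T f m : lip_on T f -> lip_on T (fun x => f x ^+ m).
Proof.
move=> Lf; elim: m => [|m IH].
  by apply: lip_on_congr (lip_on_cst T 1) => x _; rewrite expr0.
by apply: lip_on_congr (lip_onM Lf IH) => x _; rewrite exprS.
Qed.

Lemma lip_on_sum T (I : Type) (r : seq I) (F : I -> R -> R) :
  (forall i, lip_on T (F i)) -> lip_on T (fun x => \sum_(i <- r) F i x).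
Proof.
move=> H; elim: r => [|i r IH].
  by apply: lip_on_congr (lip_on_cst T 0) => x _; rewrite big_nil.
by apply: lip_on_congr (lip_onD (H i) IH) => x _; rewrite big_cons.
Qed.

Lemma lip_on_pos T f : lip_on T f -> lip_on T (fun x => Num.max 0 (f x)).
Proof.
move=> [C C0 H]; exists C => // x y xT yT; apply: le_trans (H x y xT yT).
have [fx|fx] := leP 0 (f x); have [fy|fy] := leP 0 (f y) => //.
- by rewrite subr0 (ger0_norm fx) (le_trans _ (ler_norm _)) // lerDl oppr_ge0 ltW.
- by rewrite sub0r normrN (ger0_norm fy) distrC (le_trans _ (ler_norm _)) // lerDl oppr_ge0 ltW.
- by rewrite subrr normr0.
Qed.

Lemma lip_on_locally f : (forall T, lip_on T f) ->
  [locally [lipschitz f t | t in [set t : R | 0 <= t]]].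
Proof.
move=> H [x y] [/= x0 y0].
have [C C0 HC] := H (Num.max x y + 1).
apply: klipschitzW (_ : C.-lipschitz_on f _).
  by apply: within_nbhs_proper; apply: subset_closure; split.
have N1 : \forall z \near (x, y), z.1 < Num.max x y + 1 /\ z.2 < Num.max x y + 1.
  have Hx : \forall z \near x, z < Num.max x y + 1.
    by apply: lt_nbhsl; apply: (@le_lt_trans _ _ (Num.max x y)); rewrite ?le_max ?lexx // ltrDl.
  have Hy : \forall z \near y, z < Num.max x y + 1.
    by apply: lt_nbhsl; apply: (@le_lt_trans _ _ (Num.max x y)); rewrite ?le_max ?lexx ?orbT // ltrDl.
  by exists ([set z | z < Num.max x y + 1], [set z | z < Num.max x y + 1]) => // -[].
apply: filterS N1 => -[z1 z2] [/= zx zy] [/= z10 z20].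
by apply: HC; rewrite ?z10 ?z20 /= ltW.
Qed.

End LipschitzOn.

(** * Locally finite sums of truncated powers *)

Section LocallyFiniteSum.
Context {R : realType}.
Implicit Types (t : R) (F : nat -> R -> R).

(** Zero for [t <= k - 1] and at least 1 for [t >= k]: the ramp starts one unit early so as to have
    reached height 1 at time [k]. *)
Definition ramp (k : nat) (t : R) : R := Num.max 0 (t - k%:R + 1).

(* Only the terms with k < t + 1 matter when F k vanishes off the support of [ramp k]. *)
Definition lfsum F t : R := \sum_(k < (Num.truncn t).+2) F k t.

Definition ramp_supported F := forall k t, ramp k t = 0 -> F k t = 0.

Lemma ramp0 k t : t + 1 <= k%:R -> ramp k t = 0.
Proof. by move=> tk; rewrite /ramp max_l //; lra. Qed.

Lemma sum_ramp_widen F t (A B : nat) : ramp_supported F -> (A <= B)%N -> t + 1 <= A%:R ->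
  \sum_(k < A) F k t = \sum_(k < B) F k t.
Proof.
move=> HF AB tA; rewrite -(subnKC AB) big_split_ord /=.
rewrite [X in _ + X]big1 ?addr0 // => k _; apply: HF; apply: ramp0.
by rewrite natrD (le_trans tA) // lerDl.
Qed.

(** Trades the number of terms depending on [t] for one that is constant on a half-line, which
    permits termwise differentiation. *)
Lemma lfsumE F t (K : nat) : ramp_supported F -> t < K%:R ->
  lfsum F t = \sum_(k < K.+1) F k t.
Proof.
move=> HF tK; have tN := truncnS_gt t.
have H (m : nat) : t < m%:R -> t + 1 <= m.+1%:R by rewrite -natr1 lerD2r; exact: ltW.
rewrite /lfsum; have [le|/ltnW le] := leqP (Num.truncn t).+2 K.+1.
  by apply: sum_ramp_widen => //; exact: H.
by symmetry; apply: sum_ramp_widen => //; exact: H.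
Qed.

Lemma is_derive_lfsum F dF t : ramp_supported F -> ramp_supported dF ->
  (forall k, is_derive t 1 (F k) (dF k t)) -> is_derive t 1 (lfsum F) (lfsum dF t).
Proof.
move=> HF HdF H; pose K := (Num.truncn t).+1.
have tK : t < K%:R := truncnS_gt t.
rewrite (lfsumE HdF tK).
have E : \forall s \near t, \sum_(k < K.+1) F k s = lfsum F s.
  by apply: filterS (lt_nbhsl tK) => s sK; rewrite (lfsumE HF sK).
by apply: near_eq_is_derive E _; apply: is_derive_sum_fun.
Qed.

Lemma lip_on_lfsum F T : ramp_supported F -> (forall k, lip_on T (F k)) -> lip_on T (lfsum F).
Proof.
move=> HF H; pose K := (Num.truncn T).+1.
apply: (@lip_on_congr _ _ (fun t => \sum_(k < K.+1) F k t)).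
  by move=> t /andP[_ tT]; rewrite (lfsumE HF (le_lt_trans tT (truncnS_gt T))).
exact: lip_on_sum.
Qed.

Lemma is_derive_add (f g : R -> R) (df dg : R) t :
  is_derive t 1 f df -> is_derive t 1 g dg ->
  is_derive t 1 (fun y => f y + g y) (df + dg).
Proof. by move=> Hf Hg; exact: is_deriveD. Qed.

Lemma is_derive_cstR (c t : R) : is_derive t 1 (fun=> c) 0.
Proof. exact: is_derive_cst. Qed.

Lemma is_derive_ramp k m t :
  is_derive t 1 (fun s => ramp k s ^+ m.+2) (m.+2%:R * ramp k t ^+ m.+1).
Proof.
have D : is_derive t 1 (fun s : R => s - k%:R + 1) 1.
  apply: is_derive_eq (is_derive_add (is_derive_add (is_derive_id t 1)
    (is_derive_cstR (- k%:R) t)) (is_derive_cstR 1 t)) _.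
  by rewrite !addr0.
by apply: is_derive_eq (is_derive_comp1 D (is_derive_posX m _)) _; rewrite mulr1.
Qed.

Lemma lip_on_ramp k T : lip_on T (ramp k).
Proof.
apply: lip_on_pos; apply: lip_onD; last exact: lip_on_cst.
by apply: lip_onD; [exact: lip_on_id|exact: lip_on_cst].
Qed.

End LocallyFiniteSum.

(** * The warping function and its curvature *)

Section Model.
Context {R : realType} (a : nat -> R).
Hypothesis a0 : forall k, 0 <= a k.
Implicit Types (t : R).

(** [growth], [dgrowth] and [exponent] are the functions m, m' and h. The derivative of a truncated
    cube is still locally Lipschitz, as is needed because m' enters the curvature. *)
Definition growth := lfsum (fun k t => a k * ramp k t ^+ 3).
Definition dgrowth := lfsum (fun k t => a k * (3%:R * ramp k t ^+ 2)).

(* The primitive of [t * growth t]: [t = ramp k t + (k - 1)] on the support of [ramp k]. *)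
Definition exponent :=
  lfsum (fun k t => a k * (5%:R^-1 * ramp k t ^+ 5 + (k%:R - 1) / 4%:R * ramp k t ^+ 4)).

(* [- f'' / f] for [f t = t * exp (exponent t - exponent 0)]. *)
Definition model_curv t := - (3%:R * growth t + t * dgrowth t + t ^+ 2 * growth t ^+ 2).

(** The value at 0 must be 1 for f'(0) = 1, and [exponent 0] need not vanish because [ramp 0] equals
    1 at 0. *)
Definition model_exp t := expR (exponent t - exponent 0).
Definition model_warping t := t * model_exp t.
Definition model_dwarping t := (1 + t ^+ 2 * growth t) * model_exp t.

Lemma growth_supported : ramp_supported (fun k t => a k * ramp k t ^+ 3).
Proof. by move=> k t ->; rewrite expr0n mulr0. Qed.

Lemma dgrowth_supported : ramp_supported (fun k t => a k * (3%:R * ramp k t ^+ 2)).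
Proof. by move=> k t ->; rewrite expr0n !mulr0. Qed.

Lemma is_derive_growth t : is_derive t 1 growth (dgrowth t).
Proof.
apply: is_derive_lfsum; [exact: growth_supported|exact: dgrowth_supported|move=> k].
apply: is_derive_eq (is_derive_mul (is_derive_cstR (a k) t) (is_derive_ramp k 1 t)) _.
by rewrite mul0r add0r.
Qed.

Lemma is_derive_exponent t : is_derive t 1 exponent (t * growth t).
Proof.
have -> : t * growth t = lfsum (fun k s => a k * (s * ramp k s ^+ 3)) t.
  by rewrite mulr_sumr; apply: eq_bigr => k _; rewrite mulrCA.
apply: is_derive_lfsum.
- by move=> k s ->; rewrite !expr0n !mulr0 addr0 mulr0.
- by move=> k s ->; rewrite expr0n !mulr0.
move=> k.
have D5 := is_derive_mul (is_derive_cstR 5%:R^-1 t) (is_derive_ramp k 3 t).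
have D4 := is_derive_mul (is_derive_cstR ((k%:R - 1) / 4%:R) t) (is_derive_ramp k 2 t).
apply: is_derive_eq (is_derive_mul (is_derive_cstR (a k) t) (is_derive_add D5 D4)) _.
rewrite !mul0r !add0r; congr (_ * _); rewrite /ramp.
have [_|_] := leP 0 (t - k%:R + 1); last by rewrite !expr0n !mulr0 addr0.
by field.
Qed.

Lemma is_derive_model_exp t : is_derive t 1 model_exp (model_exp t * (t * growth t)).
Proof.
have D : is_derive t 1 (fun s => exponent s + - exponent 0) (t * growth t).
  by apply: is_derive_eq (is_derive_add (is_derive_exponent t) (is_derive_cstR _ t)) _; rewrite addr0.
exact: (is_derive_comp1 D (is_derive_expR _)).
Qed.

Lemma is_derive_model_warping t : is_derive t 1 model_warping (model_dwarping t).
Proof.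
apply: is_derive_eq (is_derive_mul (is_derive_id t 1) (is_derive_model_exp t)) _.
by rewrite /model_dwarping /=; ring.
Qed.

Lemma is_derive_model_dwarping t :
  is_derive t 1 model_dwarping (- model_curv t * model_warping t).
Proof.
have D2 : is_derive t 1 (fun s : R => s ^+ 2) (2%:R * t ^+ 1) by exact: is_derive_X.
have D := is_derive_mul (is_derive_add (is_derive_cstR 1 t)
  (is_derive_mul D2 (is_derive_growth t))) (is_derive_model_exp t).
apply: is_derive_eq D _.
by rewrite /model_curv /model_warping; ring.
Qed.

Lemma derive1_model_warping : derive1 model_warping = model_dwarping.
Proof. by apply/funext => t; rewrite derive1E; have [_] := is_derive_model_warping t. Qed.

Lemma model_curv_lipschitz : [locally [lipschitz model_curv t | t in [set t : R | 0 <= t]]].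
Proof.
apply: lip_on_locally => T.
have Lc c := lip_on_cst T c.
have Lm : lip_on T growth.
  apply: lip_on_lfsum; first exact: growth_supported.
  by move=> k; apply: lip_onM => //; apply: lip_onX; exact: lip_on_ramp.
have Ldm : lip_on T dgrowth.
  apply: lip_on_lfsum; first exact: dgrowth_supported.
  by move=> k; do 2 apply: lip_onM => //; apply: lip_onX; exact: lip_on_ramp.
have Li := lip_on_id T.
apply: (@lip_on_congr _ _ (fun t => -1 * (3%:R * growth t + t * dgrowth t + t ^+ 2 * growth t ^+ 2))).
  by move=> t _; rewrite mulN1r.
apply: lip_onM => //; apply: lip_onD; first by apply: lip_onD; exact: lip_onM.
by apply: lip_onM; exact: lip_onX.
Qed.

Definition model_surface : modelSurface model_curv.
Proof.
refine (@ModelSurface R model_curv model_warping _ _ _ _ _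
  (fun t _ => \matrix_(i, j) (if i != j then 0 else if i == 0 then 1 else model_warping t ^+ 2)) _).
- move=> t _; rewrite derive1_model_warping; split.
    by have [] := is_derive_model_warping t.
  by have [] := is_derive_model_dwarping t.
- move=> t _; rewrite derive1nS derive1n1 derive1_model_warping derive1E.
  by have [_ ->] := is_derive_model_dwarping t; rewrite mulNr addNr.
- by rewrite /model_warping mul0r.
- by rewrite derive1_model_warping /model_dwarping /model_exp subrr expR0 expr0n mul0r addr0 mulr1.
- by move=> t t0; rewrite /model_warping mulr_gt0 // expR_gt0.
- by [].
Defined.

(** For [t >= 0] all three summands of f'' / f are nonnegative, and the [k]-th term of [growth]
    alone is at least [a k], the ramp being at least 1 from time [k] on. *)
Lemma model_curv_le k t : k%:R <= t -> model_curv t <= - a k.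
Proof.
move=> kt; have t0 : 0 <= t by exact: le_trans kt.
have rp j : 0 <= ramp j t by rewrite le_max lexx.
have dm0 : 0 <= dgrowth t by apply: sumr_ge0 => j _; rewrite !mulr_ge0 ?exprn_ge0.
have mk : a k <= growth t.
  have kK : (k < (Num.truncn t).+2)%N by rewrite ltnS ltnW // ltnS truncn_ge_nat.
  rewrite /growth /lfsum (bigD1 (Ordinal kK)) //=.
  apply: (@le_trans _ _ (a k * ramp k t ^+ 3)).
    by rewrite ler_peMr // exprn_ege1 // le_max; apply/orP; right; lra.
  by rewrite lerDl; apply: sumr_ge0 => j _; rewrite mulr_ge0 ?exprn_ge0.
have tdm : 0 <= t * dgrowth t by exact: mulr_ge0.
have tm : 0 <= t ^+ 2 * growth t ^+ 2 by rewrite mulr_ge0 ?sqr_ge0.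
have ak := a0 k.
by rewrite /model_curv lerN2; move: mk tdm tm ak; lra.
Qed.

End Model.

Theorem mainTheorem4 (R : realType) (n : nat) (M : riemannianManifold R n)
    (hcomplete : complete_manifold M) (hopen : open_manifold M) (p : M) :
  exists G : R -> R,
    [locally [lipschitz G t | t in [set t : R | 0 <= t]]] /\
    exists S : modelSurface G, radial_curvature_bounded_below p S.
Proof.
(* With [k] the integer part of [t], the ball of radius [k + 1] contains the point at time [t],
   while the model curvature is at most [- a k] from time [k] on. *)
have [C HC] := choice (fun k : nat => geod_ball_curvature hcomplete p k.+1%:R).
(* The absolute value weakens the bound but makes the coefficients nonnegative, as [model_curv_le]
   demands. *)
pose a k := `|C k|.
have a0 k : 0 <= a k by exact: normr_ge0.
exists (model_curv a); split; first exact: model_curv_lipschitz.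
exists (model_surface a) => c e hc c0 t t0 te sigma _ _.
have kt : (Num.truncn t)%:R <= t by rewrite -truncn_ge_nat.
apply: le_trans (model_curv_le a0 kt) _.
apply: le_trans (HC (Num.truncn t) (c t) _ sigma); first by rewrite lerN2 ler_norm.
by exists c, e, t; split=> //; split=> //; apply: ltW; exact: truncnS_gt.
Qed.
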